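(* Let $X$ be a stable white noise with parameters $(\alpha,\beta,\sigma,\mu)$ and $X_0=\int_0^1X(t)\,dt$. Then for every $m(\cdot):\mathbb N\to\mathbb N$ with $\lim_{n\to\infty} m(n)/n^{1/\alpha}=\infty$, $$\lim_{n\to\infty}\sup_{m\ge m(n)}\left|\frac{\mathcal H_{m,n}(X)}{n}-\log\frac{m}{n^{1/\alpha}}-h(X_0)\right|=0,$$ where $h(X_0)$ is the differential entropy of the continuous random variable $X_0$.
   Context: A stable white noise with parameters $\alpha\in(0,2]$, $\beta\in[-1,1]$, $\sigma>0$, $\mu\in\mathbb R$ is the generalized random process $X$ on $\mathcal S'(\mathbb R)$ with $\mathbb E[e^{j\langle X,\varphi\rangle}]=\exp(\int_{\mathbb R}f(\varphi(t))dt)$, $f(\omega)=j\omega\mu-\sigma^\alpha|\omega|^\alpha(1-j\beta\,\mathrm{sgn}(\omega)\Phi(\omega))$, $\Phi(\omega)=\tan\frac{\pi\alpha}2$ if $\alpha\ne1$ and $\Phi(\omega)=-\frac2\pi\log|\omega|$ if $\alpha=1$. For $n\in\mathbb N$, $X_1^{(n)}=\int_0^{1/n}X(t)\,dt$ (increment of the associated Lévy process) and $X_0=\int_0^1X(t)dt$. $[x]_m=\frac1m\lfloor\frac12+mx\rfloor$, $\mathcal H_{m,n}(X)=n\,H([X_1^{(n)}]_m)$ with $H$ discrete entropy (natural log). *)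

(* Defs.v *)
From HB Require Import structures.
From mathcomp Require Import all_boot all_order all_algebra.
From mathcomp Require Import all_classical all_reals all_analysis.
Set Implicit Arguments. Unset Strict Implicit. Unset Printing Implicit Defensive.
Import Order.TTheory GRing.Theory Num.Theory.
Import numFieldNormedType.Exports.
Local Open Scope classical_set_scope.
Local Open Scope ring_scope.

Section Defs.
Context {R : realType}.

Definition stable_Phi (alpha omega : R) : R :=
  if alpha == 1 then - (2 / pi) * ln `|omega| else tan (pi * alpha / 2).

(* f(omega) = j omega mu - sigma^alpha |omega|^alpha (1 - j beta sgn(omega) Phi(omega)),
   split into real and imaginary parts *)
Definition stable_f_re (alpha sigma omega : R) : R :=
  - (sigma `^ alpha) * (`|omega| `^ alpha).
Definition stable_f_im (alpha beta sigma mu omega : R) : R :=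
  omega * mu + (sigma `^ alpha) * (`|omega| `^ alpha) * beta * Num.sg omega
               * stable_Phi alpha omega.

(* E[exp(j omega Y)] = exp(t f(omega)) for every omega, written componentwise
   (real part: E[cos(omega Y)], imaginary part: E[sin(omega Y)]). *)
Definition has_cf_exp d (T : measurableType d) (P : probability T R)
  (Y : T -> R) (t alpha beta sigma mu : R) : Prop :=
  forall omega : R,
    (\int[P]_w (cos (omega * Y w))%:E =
       (expR (t * stable_f_re alpha sigma omega)
        * cos (t * stable_f_im alpha beta sigma mu omega))%:E)%E /\
    (\int[P]_w (sin (omega * Y w))%:E =
       (expR (t * stable_f_re alpha sigma omega)
        * sin (t * stable_f_im alpha beta sigma mu omega))%:E)%E.

Definition quantize (m : nat) (x : R) : R :=
  (Num.floor (2^-1 + m%:R * x))%:~R / m%:R.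

(* discrete (Shannon) entropy, natural log, of a discrete random variable Y:
   H(Y) = sum_y - P(Y = y) log P(Y = y)  (a sum of nonnegative terms, possibly +oo) *)
Definition discrete_entropy d (T : measurableType d) (P : probability T R)
  (Y : T -> R) : \bar R :=
  (\esum_(y in [set: R])
     (let p := fine (P (Y @^-1` [set y])) in (- (p * ln p))%:E))%E.

Definition Hmn d (T : measurableType d) (P : probability T R)
  (X1n : T -> R) (m n : nat) : \bar R :=
  (n%:R%:E * discrete_entropy P (fun w => quantize m (X1n w)))%E.

Definition is_density d (T : measurableType d) (P : probability T R)
  (Y : T -> R) (g : R -> R) : Prop :=
  measurable_fun [set: R] g /\ (forall x, 0 <= g x) /\
  forall A : set R, measurable A ->
    P (Y @^-1` A) = (\int[lebesgue_measure]_(x in A) (g x)%:E)%E.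

(* differential entropy h = - int g log g  (with 0 log 0 = 0) *)
Definition diff_entropy (g : R -> R) : R :=
  - Rintegral lebesgue_measure [set: R] (fun x => g x * ln (g x)).

End Defs.

(* Main.v *)
Require Import Defs.
From HB Require Import structures.
From mathcomp Require Import all_boot all_order all_algebra.
From mathcomp Require Import all_classical all_reals all_analysis.
From mathcomp Require Import measurable_realfun ring lra.
Set Implicit Arguments.
Unset Strict Implicit.
Unset Printing Implicit Defensive.
Import Order.TTheory GRing.Theory Num.Theory.
Import numFieldNormedType.Exports.
Local Open Scope classical_set_scope.
Local Open Scope ring_scope.

(* The characteristic function of [X0] is [rho(t) e^(i theta(t))] with [rho]
   decaying faster than any power, so Fourier inversion (regularised by the
   Poisson kernel, whose transform and primitive are elementary) gives [X0] a
   bounded Lipschitz density [g]. By the scaling of the stable exponent,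
   [n^(1/alpha) X1 n] minus a drift [b_n] has the same characteristic function,
   hence the same density [g].  Quantizing [X1 n] with step [1/m] therefore amounts
   to cutting the line, at an offset depending on [b_n], into cells of width
   [D = n^(1/alpha) / m], which tends to [0] uniformly in [m >= mf n].

   If [p] is the mass of a cell, [- p ln (p / D)] exceeds the integral of
   [- g ln g] over the cell by a relative entropy, which is nonnegative.  Where [g]
   is not small, the Lipschitz bound makes it small; where [g] is small,
   Gibbs' inequality against a multiple of [1 / (1 + x^2)] bounds it by tails of
   [g ln (1 + x^2)], uniformly in the offset.  This function is integrable since
   the mass of the dyadic annulus of radius [2^n] is controlled by the deviation
   from [1] of the characteristic function at [2^-n]. *)

(** * Laplace transforms of [1] and of the cosine on the half-line *)

Section poisson_kernel.
Context {R : realType}.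
Local Notation mu := (@lebesgue_measure R).

Lemma cvgy_expRN (e : R) : 0 < e -> expR (- (e * w)) @[w --> +oo] --> (0 : R).
Proof.
move=> e0; apply: (cvg_comp (fun w => e * w) (fun z => expR (- z))).
  exact: (gt0_cvgMry e0 cvg_id).
exact: cvgr_expR.
Qed.

Lemma integral_expRN (e : R) : 0 < e ->
  (\int[mu]_(w in `[0%R, +oo[) (expR (- (e * w)))%:E = (e^-1)%:E)%E.
Proof.
move=> e0.
pose F (w : R) := - e^-1 * expR (- (e * w)).
have dF (x : R) : is_derive x 1 F (expR (- (e * x))).
  apply: is_derive_eq; rewrite ?scaler0 ?add0r /GRing.scale/=.
  by field; rewrite gt_eqF.
rewrite (@ge0_continuous_FTC2y _ _ F _ 0).
- by rewrite /F mulr0 oppr0 expR0 mulr1 -EFinB sub0r opprK.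
- by move=> x _; exact: expR_ge0.
- apply/continuous_subspaceT => x; apply: continuous_comp; last exact: continuous_expR.
  by apply: cvgN; apply: cvgM; [exact: cvg_cst|exact: cvg_id].
- by rewrite -[0 in X in _ --> X](mulr0 (- e^-1)); apply: cvgMl_tmp; exact: cvgy_expRN.
- by move=> x _; exact: (@ex_derive _ _ _ _ _ _ _ (dF x)).
- apply: cvg_at_right_filter; apply: differentiable_continuous; apply/derivable1_diffP.
  exact: (@ex_derive _ _ _ _ _ _ _ (dF 0)).
- by move=> x _; rewrite derive1E (@derive_val _ _ _ _ _ _ _ (dF x)).
Qed.

(** Adding [1] to the cosine makes the integrand nonnegative, so that the fundamental theorem of
    calculus on the half-line for nonnegative functions applies. The Poisson kernel is recovered in
    [integral_expRN_cos] by subtracting [integral_expRN]. *)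
Lemma integral_expRN_1Dcos (e y : R) : 0 < e ->
  (\int[mu]_(w in `[0%R, +oo[) (expR (- (e * w)) * (1 + cos (w * y)))%:E =
   (e^-1 + e / (e ^+ 2 + y ^+ 2))%:E)%E.
Proof.
move=> e0.
have D0 : e ^+ 2 + y ^+ 2 != 0 by rewrite gt_eqF// ltr_pwDl ?exprn_gt0 ?sqr_ge0.
pose F (w : R) := expR (- (e * w)) *
  (- e^-1 + (y * sin (w * y) - e * cos (w * y)) / (e ^+ 2 + y ^+ 2)).
have dF (x : R) : is_derive x 1 F (expR (- (e * x)) * (1 + cos (x * y))).
  apply: is_derive_eq; rewrite ?scaler0 ?add0r /GRing.scale/=.
  by field; rewrite D0 gt_eqF.
rewrite (@ge0_continuous_FTC2y _ _ F _ 0).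
- rewrite /F mulr0 oppr0 expR0 mul0r sin0 cos0 -EFinB; congr EFin.
  by field; rewrite D0 gt_eqF.
- by move=> x _; rewrite mulr_ge0 ?expR_ge0// -lerBlDl sub0r cos_geN1.
- apply/continuous_subspaceT => x; apply: cvgM.
    apply: continuous_comp; last exact: continuous_expR.
    by apply: cvgN; apply: cvgM; [exact: cvg_cst|exact: cvg_id].
  apply: cvgD; first exact: cvg_cst.
  apply: continuous_comp; last exact: continuous_cos.
  by apply: cvgM; [exact: cvg_id|exact: cvg_cst].
(* [K] bounds the bracket in [F] uniformly in [w], so the exponential factor alone drives [F] to
   [0]. *)
- pose K := e^-1 + (`|y| + e) / (e ^+ 2 + y ^+ 2).
  apply: norm_cvg0.
  apply: (@squeeze_cvgr _ _ _ _ (cst 0) (fun w => expR (- (e * w)) * K)).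
  + apply: nearW => w; rewrite normr_ge0/= normrM ger0_norm ?expR_ge0//.
    rewrite ler_wpM2l ?expR_ge0// (le_trans (ler_normD _ _))// normrN.
    rewrite gtr0_norm ?invr_gt0// lerD2l normrM normfV.
    rewrite (gtr0_norm (x := e ^+ 2 + _)) ?lt0r ?D0 ?addr_ge0 ?sqr_ge0//.
    rewrite ler_wpM2r ?invr_ge0 ?addr_ge0 ?sqr_ge0//.
    rewrite (le_trans (ler_normB _ _))// !normrM (gtr0_norm e0).
    by rewrite lerD// ler_piMr ?(ltW e0)// ler_norml ?sin_geN1 ?sin_le1 ?cos_geN1 ?cos_le1.
  + exact: cvg_cst.
  + by rewrite -[0 in X in _ --> X](mul0r K); apply: cvgMr_tmp; exact: cvgy_expRN.
- by move=> x _; exact: (@ex_derive _ _ _ _ _ _ _ (dF x)).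
- apply: cvg_at_right_filter; apply: differentiable_continuous; apply/derivable1_diffP.
  exact: (@ex_derive _ _ _ _ _ _ _ (dF 0)).
- by move=> x _; rewrite derive1E (@derive_val _ _ _ _ _ _ _ (dF x)).
Qed.

Lemma continuous_expRN (e : R) : continuous (fun w : R => expR (- (e * w))).
Proof.
move=> x; apply: continuous_comp; last exact: continuous_expR.
by apply: cvgN; apply: cvgM; [exact: cvg_cst|exact: cvg_id].
Qed.

Lemma integrable_expRN (e : R) : 0 < e ->
  mu.-integrable `[0%R, +oo[ (fun w => (expR (- (e * w)))%:E).
Proof.
move=> e0; apply/integrableP; split.
  apply/measurable_EFinP/measurable_funTS.
  exact: continuous_measurable_fun (@continuous_expRN e).
under eq_integral do rewrite gee0_abs ?lee_fin ?expR_ge0//.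
by rewrite integral_expRN// ltry.
Qed.

Lemma integral_expRN_cos (e y : R) : 0 < e ->
  (\int[mu]_(w in `[0%R, +oo[) (expR (- (e * w)) * cos (w * y))%:E =
   (e / (e ^+ 2 + y ^+ 2))%:E)%E.
Proof.
move=> e0.
have mE : measurable_fun (`[0, +oo[ : set R) (fun w : R => expR (- (e * w))).
  by apply: measurable_funTS; exact: continuous_measurable_fun (@continuous_expRN e).
have mc : measurable_fun (`[0, +oo[ : set R) (fun w : R => cos (w * y)).
  apply: measurable_funTS; apply: continuous_measurable_fun => x.
  apply: continuous_comp; last exact: continuous_cos.
  by apply: cvgM; [exact: cvg_id|exact: cvg_cst].
transitivity (\int[mu]_(w in `[0%R, +oo[)
  ((expR (- (e * w)) * (1 + cos (w * y)))%:E - (expR (- (e * w)))%:E))%E.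
  by apply: eq_integral => w _; rewrite -EFinB; congr EFin; ring.
rewrite integralB_EFin//.
- rewrite integral_expRN_1Dcos// integral_expRN// -EFinB; congr EFin; ring.
- apply/integrableP; split.
    apply/measurable_EFinP; apply: measurable_funM => //.
    exact: measurable_funD.
  under eq_integral.
    move=> w _; rewrite /= ger0_norm; last first.
      by rewrite mulr_ge0 ?expR_ge0// -lerBlDl sub0r cos_geN1.
    over.
  by rewrite integral_expRN_1Dcos// ltry.
- exact: integrable_expRN.
Qed.

End poisson_kernel.

(** * Expectation of the Poisson kernel in terms of the characteristic function *)

Section fourier.
Context {R : realType} (d : measure_display) (T : measurableType d)
  (P : probability T R).
Local Notation mu := (@lebesgue_measure R).

Lemma bounded_integrable (f : T -> R) (K : R) : measurable_fun [set: T] f ->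
  (forall w, `|f w| <= K) -> P.-integrable [set: T] (fun w => (f w)%:E).
Proof.
move=> mf fK; apply: (@measurable_bounded_integrable _ _ _ P f) => //.
  exact: le_lt_trans (probability_le1 P measurableT) (ltry 1).
exists K; split; first exact: num_real.
by move=> M KM w _ /=; exact: le_trans (fK w) (ltW KM).
Qed.

(** The integrand is dominated by [|r t|], which is integrable for the product measure because [P]
    has total mass [1]. *)
Lemma fubini_cos (Y : {RV P >-> R}) (r : R -> R) (x : R) :
  mu.-integrable [set: R] (fun t => (r t)%:E) ->
  (\int[P]_w \int[mu]_t (r t * cos (t * (Y w - x)))%:E =
   \int[mu]_t \int[P]_w (r t * cos (t * (Y w - x)))%:E)%E.
Proof.
move=> ir; have mr : measurable_fun [set: R] r.
  by apply/measurable_EFinP; exact: (measurable_int _ ir).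
pose f (z : T * R) : \bar R := (r z.2 * cos (z.2 * (Y z.1 - x)))%:E.
have mf : measurable_fun [set: T * R] f.
  apply/measurable_EFinP; apply: measurable_funM.
    exact: measurableT_comp mr measurable_snd.
  apply: measurableT_comp; first exact: continuous_measurable_fun (@continuous_cos R).
  apply: measurable_funM; first exact: measurable_snd.
  apply: measurable_funB; last exact: measurable_cst.
  by apply: measurableT_comp.
have mf1 : measurable_fun [set: T * R] (fun z => `|f z|%E) by exact: measurableT_comp.
apply: (@Fubini _ _ _ _ _ P mu f).
apply/integrable12ltyP => //.
pose K := (\int[mu]_t `|(r t)%:E|)%E.
have Ky : (K < +oo)%E by case/integrableP : ir.
have K0 : (0 <= K)%E by exact: integral_ge0.
apply: (@le_lt_trans _ _ (\int[P]_w (fine K)%:E)%E); last first.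
  rewrite integral_cst// (_ : _ [set: T] = 1%E) ?mule1 ?ltry//.
  exact: probability_setT.
apply: ge0_le_integral => //.
- by move=> w _; exact: integral_ge0.
- by apply: (@measurable_fun_fubini_tonelli_F _ _ _ _ _ mu (fun z => `|f z|%E)).
move=> w _; rewrite fineK ?ge0_fin_numE//; apply: ge0_le_integral => //.
- exact: measurableT_comp mf1 (measurable_pair1 w).
- by apply: measurableT_comp => //; exact/measurable_EFinP.
- move=> t _ /=; rewrite lee_fin normrM ler_piMr//.
  by rewrite ler_norml cos_geN1 cos_le1.
Qed.

Context (Y : {RV P >-> R}) (rho theta : R -> R).
Hypothesis cosY : forall t, 0 <= t ->
  (\int[P]_w (cos (t * Y w))%:E = (rho t * cos (theta t))%:E)%E.
Hypothesis sinY : forall t, 0 <= t ->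
  (\int[P]_w (sin (t * Y w))%:E = (rho t * sin (theta t))%:E)%E.

Lemma measurable_cosY t : measurable_fun [set: T] (fun w => cos (t * Y w)).
Proof.
apply: (measurableT_comp (continuous_measurable_fun (@continuous_cos R))).
exact: measurable_funM.
Qed.

Lemma measurable_sinY t : measurable_fun [set: T] (fun w => sin (t * Y w)).
Proof.
apply: (measurableT_comp (continuous_measurable_fun (@continuous_sin R))).
exact: measurable_funM.
Qed.

Lemma integrable_cosY t : P.-integrable [set: T] (fun w => (cos (t * Y w))%:E).
Proof.
apply: (@bounded_integrable _ 1); first exact: measurable_cosY.
by move=> w; rewrite ler_norml cos_geN1 cos_le1.
Qed.

Lemma integrable_sinY t : P.-integrable [set: T] (fun w => (sin (t * Y w))%:E).
Proof.
apply: (@bounded_integrable _ 1); first exact: measurable_sinY.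
by move=> w; rewrite ler_norml sin_geN1 sin_le1.
Qed.

Lemma integral_cosB (t x : R) : 0 <= t ->
  (\int[P]_w (cos (t * (Y w - x)))%:E = (rho t * cos (t * x - theta t))%:E)%E.
Proof.
move=> t0.
have [ic is_] := (integrable_cosY t, integrable_sinY t).
transitivity (\int[P]_w ((cos (t * x))%:E * (cos (t * Y w))%:E +
    (sin (t * x))%:E * (sin (t * Y w))%:E))%E.
  apply: eq_integral => w _; rewrite -!EFinM -EFinD; congr EFin.
  by rewrite mulrBr cosB; ring.
rewrite integralD//; try exact: integrableZl.
rewrite !integralZl// cosY// sinY// -!EFinM -EFinD; congr EFin.
by rewrite cosB; ring.
Qed.

Lemma integral_sinB (t x : R) : 0 <= t ->
  (\int[P]_w (sin (t * (Y w - x)))%:E = (rho t * sin (theta t - t * x))%:E)%E.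
Proof.
move=> t0; have [ic is_] := (integrable_cosY t, integrable_sinY t).
transitivity (\int[P]_w ((cos (t * x))%:E * (sin (t * Y w))%:E -
    (sin (t * x))%:E * (cos (t * Y w))%:E))%E.
  apply: eq_integral => w _; rewrite -!EFinM -EFinB; congr EFin.
  by rewrite mulrBr sinB; ring.
rewrite integralB//; try exact: integrableZl.
rewrite !integralZl// cosY// sinY// -!EFinM -EFinB; congr EFin.
by rewrite sinB; ring.
Qed.

(** The kernel is the Laplace transform of a cosine. After exchanging the integrals, the expectation
    of that cosine is read off the characteristic function. *)
Lemma poisson_cf (e x : R) : 0 < e ->
  (\int[P]_w (e / (e ^+ 2 + (Y w - x) ^+ 2))%:E =
   \int[mu]_(t in `[0%R, +oo[) (expR (- (e * t)) * (rho t * cos (t * x - theta t)))%:E)%E.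
Proof.
move=> e0.
pose D : set R := `[0, +oo[%classic.
(* Extension by zero turns the half-line integral into one over the whole line, the form
   [fubini_cos] takes. *)
pose r := (fun t : R => expR (- (e * t))) \_ D.
have ir : mu.-integrable [set: R] (fun t => (r t)%:E).
  rewrite (_ : (fun t => _) = (EFin \o (fun t : R => expR (- (e * t)))) \_ D).
    apply/integrable_restrict; [exact: measurable_itv|by []|rewrite setTI].
    exact: integrable_expRN.
  by rewrite restrict_EFin.
transitivity (\int[P]_w \int[mu]_t (r t * cos (t * (Y w - x)))%:E)%E.
  apply: eq_integral => w _; rewrite -integral_expRN_cos// integral_mkcond.
  apply: eq_integral => t _; rewrite /r !patchE; case: ifPn => //.
  by rewrite mul0r.
rewrite fubini_cos// [RHS]integral_mkcond; apply: eq_integral => t _.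
rewrite /r !patchE; case: ifPn => tD; last first.
  by under eq_integral do rewrite mul0r; rewrite integral0.
have t0 : 0 <= t by move: tD; rewrite inE /D/= in_itv/= andbT.
under eq_integral do rewrite EFinM.
rewrite integralZl//.
  by rewrite integral_cosB// -EFinM.
apply: (@bounded_integrable _ 1).
  apply: (measurableT_comp (continuous_measurable_fun (@continuous_cos R))).
  by apply: measurable_funM => //; exact: measurable_funB.
by move=> w; rewrite ler_norml cos_geN1 cos_le1.
Qed.

End fourier.

(** * The inverse Fourier integral: boundedness, regularity, removal of the damping *)

Section oscillatory_integral.
Context {R : realType} (theta : R -> R).
Local Notation mu := (@lebesgue_measure R).
Local Notation D := (`[0%R, +oo[%classic : set R).
Hypothesis mtheta : measurable_fun D theta.

(** For the characteristic function [q e^(i theta)] this is [pi] times the inverse Fourier transform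
    at [x], folded onto the half-line by conjugate symmetry. *)
Definition osc_integral (q : R -> R) (x : R) : R :=
  (\int[mu]_(t in D) (q t * cos (t * x - theta t)))%R.

Lemma measurable_osc (q : R -> R) (x : R) : measurable_fun D q ->
  measurable_fun D (fun t => q t * cos (t * x - theta t)).
Proof.
move=> mq; apply: measurable_funM => //.
apply: measurableT_comp; first exact: continuous_measurable_fun (@continuous_cos R).
by apply: measurable_funB => //; exact: measurable_funM.
Qed.

Lemma integrable_osc (q : R -> R) (x : R) :
  mu.-integrable D (fun t => (q t)%:E) ->
  mu.-integrable D (fun t => (q t * cos (t * x - theta t))%:E).
Proof.
move=> iq; apply: (le_integrable _ _ _ iq) => //.
  apply/measurable_EFinP; apply: measurable_osc; apply/measurable_EFinP.
  exact: (measurable_int mu iq).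
move=> t _ /=; rewrite lee_fin normrM ler_piMr//.
by rewrite ler_norml cos_geN1 cos_le1.
Qed.

Lemma osc_integral_bounded (q : R -> R) (x : R) :
  mu.-integrable D (fun t => (q t)%:E) ->
  `|osc_integral q x| <= (\int[mu]_(t in D) `|q t|)%R.
Proof.
move=> iq; have iqx := integrable_osc x iq.
apply: (le_trans (le_normr_Rintegral _ iqx)) => //.
apply: le_Rintegral => //; first exact: integrable_norm.
- exact: integrable_norm.
- move=> t _ /=; rewrite normrM ler_piMr//.
  by rewrite ler_norml cos_geN1 cos_le1.
Qed.

Lemma cos_lipschitz (x y : R) : `|cos x - cos y| <= `|x - y|.
Proof.
wlog xy : x y / x < y.
  move=> H; have [|yx|->] := ltgtP x y; first exact: H.
    by rewrite distrC [leRHS]distrC; exact: H.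
  by rewrite !subrr.
have dc z : z \in `]x, y[ -> is_derive z 1 cos (- sin z).
  by move=> _; exact: is_derive_cos.
have cc : {within `[x, y], continuous cos}.
  by apply: continuous_subspaceT; exact: continuous_cos.
have [c _ h] := MVT xy dc cc.
rewrite distrC h normrM [leRHS]distrC ler_piMl// normrN.
by rewrite ler_norml sin_geN1 sin_le1.
Qed.

(** The cosine is 1-Lipschitz, so changing [x] to [y] changes the integrand by at most
    [|t q(t)| |x - y|]. *)
Lemma osc_integral_lipschitz (q : R -> R) (x y : R) :
  mu.-integrable D (fun t => (q t)%:E) ->
  mu.-integrable D (fun t => (t * q t)%:E) ->
  `|osc_integral q x - osc_integral q y| <=
    (\int[mu]_(t in D) `|t * q t|)%R * `|x - y|.
Proof.
move=> iq itq; rewrite /osc_integral -RintegralB//; [|exact: integrable_osc..].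
have iqxy : mu.-integrable D (EFin \o (fun t =>
    q t * cos (t * x - theta t) - q t * cos (t * y - theta t))).
  have := @integrableB _ _ _ mu D _ _ _ (integrable_osc x iq) (integrable_osc y iq).
  by apply; exact: measurable_itv.
apply: (le_trans (le_normr_Rintegral _ iqxy)) => //.
have in1 : mu.-integrable D (EFin \o (fun t => `|t * q t|)) by exact: integrable_norm.
rewrite -RintegralZr//; apply: le_Rintegral => //.
- exact: integrable_norm.
- have := @integrableZr _ _ _ mu D _ `|x - y| _ in1.
  by apply; exact: measurable_itv.
- move=> t; rewrite /= in_itv/= andbT => t0.
  rewrite -mulrBr !normrM (mulrC `|t|) -mulrA ler_wpM2l// -normrM.
  rewrite (le_trans (cos_lipschitz _ _))//.
  by rewrite le_eqVlt; apply/orP; left; apply/eqP; congr (`| _ |); ring.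
Qed.

Lemma lipschitz_continuous (f : R -> R) (K : R) :
  (forall x y, `|f x - f y| <= K * `|x - y|) -> continuous f.
Proof.
move=> fK x; apply/cvgrPdist_le => /= e e0.
have K0 : 0 < `|K| + 1 by rewrite ltr_wpDl.
near=> y; rewrite (le_trans (fK _ _))//.
rewrite (@le_trans _ _ ((`|K| + 1) * `|x - y|))//.
  by rewrite ler_wpM2r// (le_trans (ler_norm _))// lerDl.
rewrite mulrC -ler_pdivlMr//; near: y.
have xx : y @[y --> x] --> x by exact: cvg_id.
by move/cvgrPdist_le : xx; apply; rewrite divr_gt0.
Unshelve. all: by end_near. Qed.

Lemma continuous_osc_integral (q : R -> R) :
  mu.-integrable D (fun t => (q t)%:E) ->
  mu.-integrable D (fun t => (t * q t)%:E) -> continuous (osc_integral q).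
Proof.
move=> iq itq; apply: lipschitz_continuous => x y.
exact: osc_integral_lipschitz.
Qed.

Lemma le_damped (q : R -> R) (e t : R) : 0 <= e -> 0 <= t ->
  `|expR (- (e * t)) * q t| <= `|q t|.
Proof.
move=> e0 t0; rewrite normrM ler_piMl// ger0_norm ?expR_ge0//.
by rewrite -expR0 ler_expR oppr_le0 mulr_ge0.
Qed.

Lemma integrable_damped (q : R -> R) (e : R) : 0 <= e ->
  mu.-integrable D (fun t => (q t)%:E) ->
  mu.-integrable D (fun t => (expR (- (e * t)) * q t)%:E).
Proof.
move=> e0 iq; apply: (le_integrable _ _ _ iq) => //.
  apply/measurable_EFinP; apply: measurable_funM.
    apply: measurable_funTS; exact: continuous_measurable_fun (@continuous_expRN _ e).
  by apply/measurable_EFinP; exact: (measurable_int mu iq).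
move=> t; rewrite /= in_itv/= andbT => t0.
by rewrite lee_fin le_damped.
Qed.

(** Dominated convergence with majorant [|q|]. It lets the parameter of the Poisson kernel tend to
    [0] along [1 / (n + 1)]. *)
Lemma cvg_damped_osc (q : R -> R) (x : R) :
  mu.-integrable D (fun t => (q t)%:E) ->
  osc_integral (fun t => expR (- (n.+1%:R^-1 * t)) * q t) x @[n --> \oo]
    --> osc_integral q x.
Proof.
move=> iq; apply: fine_cvg; rewrite fineK; last first.
  apply: (@integrable_fin_num _ _ _ mu) => //; exact: integrable_osc.
have [] := @dominated_convergence _ _ _ mu D _
  (fun n t => (expR (- (n.+1%:R^-1 * t)) * q t * cos (t * x - theta t))%:E)
  (fun t => (q t * cos (t * x - theta t))%:E) (fun t => `|q t|%:E) => //.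
- move=> n; apply: (measurable_int mu); apply: integrable_osc; exact: integrable_damped.
- apply: (measurable_int mu); exact: integrable_osc.
- apply: aeW => t _; apply: cvg_EFin; first by apply: nearW.
  apply: cvgMr_tmp; rewrite -[X in _ --> X]mul1r; apply: cvgMr_tmp.
  rewrite -[X in _ --> X]expR0; apply: continuous_cvg; first exact: continuous_expR.
  rewrite -[X in _ --> X]oppr0; apply: cvgN; rewrite -[X in _ --> X](mul0r t); apply: cvgMr_tmp.
  exact: cvg_harmonic.
- exact: integrable_norm.
- apply: aeW => t n; rewrite /= in_itv/= andbT => t0.
  rewrite lee_fin normrM (le_trans (ler_piMr _ _))//.
    by rewrite ler_norml cos_geN1 cos_le1.
  exact: le_damped.
Qed.

End oscillatory_integral.

(** * Primitive of the Poisson kernel and its limit *)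

Section arctan.
Context {R : realType}.
Local Notation mu := (@lebesgue_measure R).

Lemma integral_cauchy_kernel (e y a b : R) : 0 < e -> a < b ->
  (\int[mu]_(x in `[a, b]) (e / (e ^+ 2 + (y - x) ^+ 2))%:E =
   (atan ((b - y) / e) - atan ((a - y) / e))%:E)%E.
Proof.
move=> e0 ab.
have D0 (x : R) : e ^+ 2 + (y - x) ^+ 2 != 0.
  by rewrite gt_eqF// ltr_pwDl ?exprn_gt0 ?sqr_ge0.
pose F (x : R) := atan ((x - y) / e).
have dF (x : R) : is_derive x 1 F (e / (e ^+ 2 + (y - x) ^+ 2)).
  pose h (z : R) := (z - y) / e.
  have dh : is_derive x 1 h e^-1.
    by apply: is_derive_eq; rewrite ?scaler0 ?add0r /GRing.scale/=; ring.
  have := @is_derive1_comp _ atan h x _ _ (is_derive1_atan (h x)) dh.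
  move=> H; apply: (@is_derive_eq _ _ _ _ _ _ _ _ H).
  by rewrite /h; field; rewrite D0 (gt_eqF e0).
have cF : continuous F.
  move=> x; apply: differentiable_continuous; apply/derivable1_diffP.
  exact: (@ex_derive _ _ _ _ _ _ _ (dF x)).
rewrite (@continuous_FTC2 _ _ F)//.
- apply/continuous_subspaceT => x; apply: cvgM; first exact: cvg_cst.
  apply: cvgV; first exact: D0.
  apply: cvgD; first exact: cvg_cst.
  by apply: cvgM; (apply: cvgB; [exact: cvg_cst|exact: cvg_id]).
- split.
  + by move=> x _; exact: (@ex_derive _ _ _ _ _ _ _ (dF x)).
  + by apply: cvg_at_right_filter; exact: cF.
  + by apply: cvg_at_left_filter; exact: cF.
- by move=> x _; rewrite derive1E (@derive_val _ _ _ _ _ _ _ (dF x)).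
Qed.

Lemma cvg_atan_seq (c : R) : 0 < c ->
  atan (c / n.+1%:R^-1) @[n --> \oo] --> (pi / 2 : R).
Proof.
move=> c0; apply: (cvg_comp (fun n : nat => c / n.+1%:R^-1) (@atan R) _ (@cvgy_atan R)).
under eq_fun do rewrite invrK.
apply: (cvg_comp (fun n : nat => n.+1%:R) (fun z : R => c * z) _ (gt0_cvgMry c0 cvg_id)).
have := (@cvgr_idn R).
by rewrite -(cvg_shiftn 1); under eq_fun do rewrite addn1.
Qed.

Lemma cvg_atan_seqN (c : R) : c < 0 ->
  atan (c / n.+1%:R^-1) @[n --> \oo] --> (- (pi / 2) : R).
Proof.
move=> c0; rewrite -oppr_gt0 in c0.
have := cvg_atan_seq c0 => /cvgN; apply: cvg_trans.
apply: near_eq_cvg; apply: nearW => n.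
by rewrite /= fctE mulNr atanN opprK.
Qed.

(** The endpoints are excluded because the limit there is [pi / 2], which is neither [0] nor [pi].
    In the application they form a null event by [cf_no_atom]. *)
Lemma cvg_atan_indic (a b y : R) : a < b -> y != a -> y != b ->
  atan ((b - y) / n.+1%:R^-1) - atan ((a - y) / n.+1%:R^-1) @[n --> \oo]
    --> pi * \1_(`]a, b]%classic) y.
Proof.
move=> ab ya yb; rewrite indicE.
have [ylta|] := ltP y a.
  rewrite memNset/=; last by rewrite in_itv/= ltNge (ltW ylta).
  rewrite mulr0 -(subrr (pi / 2)); apply: cvgB; apply: cvg_atan_seq; rewrite subr_gt0//.
  exact: lt_trans ab.
rewrite le_eqVlt eq_sym (negbTE ya)/= => alty.
have [yltb|] := ltP y b.
  rewrite mem_set/=; last by rewrite in_itv/= alty ltW.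
  rewrite mulr1 [X in _ --> X](_ : _ = pi / 2 - - (pi / 2)); last by lra.
  apply: cvgB; first by apply: cvg_atan_seq; rewrite subr_gt0.
  by apply: cvg_atan_seqN; rewrite subr_lt0.
rewrite le_eqVlt eq_sym (negbTE yb)/= => blty.
rewrite memNset/=; last by rewrite in_itv/= alty/= leNgt blty.
rewrite mulr0 -(subrr (- (pi / 2))); apply: cvgB; apply: cvg_atan_seqN; rewrite subr_lt0//.
Qed.

End arctan.

(** * Measures with a density, and their identification on half-open intervals *)

Section density_measure.
Context {R : realType} (g : R -> R).
Local Notation mu := (@lebesgue_measure R).

(** The proofs [mg] and [g0] are arguments so that the measure structure declared below can be
    inferred from the term itself. *)
Definition density_measure (mg : measurable_fun [set: R] g)
  (g0 : forall x, 0 <= g x) (A : set R)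
  : \bar R := (\int[mu]_(x in A) (g x)%:E)%E.

Hypotheses (mg : measurable_fun [set: R] g) (g0 : forall x, 0 <= g x).

Let density_measure0 : density_measure mg g0 set0 = 0%E.
Proof. by rewrite /density_measure integral_set0. Qed.

Let density_measure_ge0 A : (0 <= density_measure mg g0 A)%E.
Proof. by apply: integral_ge0 => x _; rewrite lee_fin. Qed.

Let density_measure_sigma_additive : semi_sigma_additive (density_measure mg g0).
Proof.
move=> /= A mA tA mUA; rewrite /density_measure/= ge0_integral_bigcup//=.
- apply: is_cvg_ereal_nneg_natsum_cond => n _ _.
  by apply: integral_ge0 => x _; rewrite lee_fin.
- by apply/measurable_EFinP; apply: measurable_funTS.
- by move=> x _; rewrite lee_fin.
Qed.

HB.instance Definition _ := isMeasure.Build default_measure_display R R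
  (density_measure mg g0)
  density_measure0 density_measure_ge0 density_measure_sigma_additive.

End density_measure.

(** Half-open intervals are stable under intersection and generate the Borel sets, and the intervals
    []-n, n]] of finite mass exhaust the line; two measures agreeing on them coincide. *)
Lemma is_density_of_itv {R : realType} (d : measure_display)
    (T : measurableType d) (P : probability T R) (Y : {RV P >-> R}) (g : R -> R) :
  measurable_fun [set: R] g -> (forall x, 0 <= g x) ->
  (forall a b : R, (a < b)%R -> P (Y @^-1` `]a, b]) =
    \int[lebesgue_measure]_(x in `]a, b]) (g x)%:E)%E ->
  is_density P Y g.
Proof.
move=> mg g0 hI; split => //; split => // A mA.
have -> : P (Y @^-1` A) = distribution P Y A by [].
apply: (@measure_unique _ R R (@ocitv R) (fun n => `](- n%:R), n%:R]%classic)
  _ _ _ _ (distribution P Y) (density_measure mg g0)) => //.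
- exact: ocitvI.
- by move=> n; exact: is_ocitv.
- exact: bigcup_itvT.
- move=> _ [[a b] _ <-] /=; have [ab|ba] := ltP a b.
    by rewrite /distribution /pushforward hI.
  by rewrite set_itv_ge ?bnd_simp -?leNgt// !measure0.
- by move=> n; exact: le_lt_trans (probability_le1 (distribution P Y) (measurable_itv _)) (ltry 1).
Qed.

(** * Fourier inversion for an integrable characteristic function *)

Section fourier_inversion.
Context {R : realType} (d : measure_display) (T : measurableType d)
  (P : probability T R) (Y : {RV P >-> R}) (rho theta : R -> R).
Local Notation mu := (@lebesgue_measure R).
Local Notation D := (`[0%R, +oo[%classic : set R).
Hypothesis cosY : forall t, 0 <= t ->
  (\int[P]_w (cos (t * Y w))%:E = (rho t * cos (theta t))%:E)%E.
Hypothesis sinY : forall t, 0 <= t ->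
  (\int[P]_w (sin (t * Y w))%:E = (rho t * sin (theta t))%:E)%E.
Hypothesis mtheta : measurable_fun D theta.
Hypothesis irho : mu.-integrable D (fun t => (rho t)%:E).
Hypothesis itrho : mu.-integrable D (fun t => (t * rho t)%:E).

Let damped (e : R) := fun t : R => expR (- (e * t)) * rho t.

Let damped_osc (e x : R) : 0 < e ->
  (\int[P]_w (e / (e ^+ 2 + (Y w - x) ^+ 2))%:E =
   (osc_integral theta (damped e) x)%:E)%E.
Proof.
move=> e0; rewrite (poisson_cf cosY sinY)//.
rewrite /osc_integral /Rintegral fineK.
  by apply: eq_integral => t _; rewrite /damped mulrA.
apply: (@integrable_fin_num _ _ _ mu) => //; apply: integrable_osc => //.
by apply: integrable_damped => //; exact: ltW.
Qed.

(** On the event [Y = x] the Poisson kernel equals [1 / e], so the probability is at most [e] times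
    the expected kernel. That expectation is bounded by the integral of [|rho|] for every [e]. *)
Lemma cf_no_atom (x : R) : P (Y @^-1` [set x]) = 0%E.
Proof.
have mx : measurable (Y @^-1` [set x]) by exact: measurable_funPTI.
pose K := (\int[mu]_(t in D) `|rho t|)%R.
have K0 : 0 <= K by exact: Rintegral_ge0.
suff H (e : R) : 0 < e -> (P (Y @^-1` [set x]) <= (e * K)%:E)%E.
  apply/eqP; rewrite eq_le measure_ge0 andbT.
  apply/lee_addgt0Pr => e e0; rewrite add0e.
  have e1 : 0 < e / (K + 1) by rewrite divr_gt0// ltr_wpDl.
  apply: (le_trans (H _ e1)); rewrite lee_fin -mulrA ler_piMr ?(ltW e0)//.
  by rewrite mulrC ler_pdivrMr ?ltr_wpDl// mul1r lerDl.
move=> e0.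
have q0 w : 0 <= e / (e ^+ 2 + (Y w - x) ^+ 2).
  by rewrite divr_ge0 ?(ltW e0)// addr_ge0 ?sqr_ge0.
have mq : measurable_fun [set: T] (fun w => e / (e ^+ 2 + (Y w - x) ^+ 2)).
  apply: (measurableT_comp (f := fun z : R => e / (e ^+ 2 + (z - x) ^+ 2))) => //.
  apply: continuous_measurable_fun => z; apply: cvgM; first exact: cvg_cst.
  apply: cvgV; first by rewrite gt_eqF// ltr_pwDl ?exprn_gt0 ?sqr_ge0.
  apply: cvgD; first exact: cvg_cst.
  by apply: cvgM; (apply: cvgB; [exact: cvg_id|exact: cvg_cst]).
rewrite -(_ : (\int[P]_w (\1_(Y @^-1` [set x]) w)%:E = P (Y @^-1` [set x]))%E); last first.
  by rewrite integral_indic// setIT.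
apply: (@le_trans _ _ (\int[P]_w (e%:E * (e / (e ^+ 2 + (Y w - x) ^+ 2))%:E))%E).
  apply: ge0_le_integral => //.
  - by apply/measurable_EFinP.
  - apply: measurable_funeM; exact/measurable_EFinP.
  - move=> w _; rewrite -EFinM lee_fin indicE.
    have [/set_mem /= ->|_] := boolP (w \in _).
      by rewrite subrr expr0n addr0 mulrA -expr2 divff// gt_eqF// exprn_gt0.
    by rewrite mulr_ge0// ltW.
rewrite ge0_integralZl_EFin//; last 3 first.
- by move=> w _; rewrite lee_fin.
- exact/measurable_EFinP.
- exact: ltW.
rewrite damped_osc// -EFinM lee_fin ler_wpM2l ?(ltW e0)//.
apply: (le_trans (ler_norm _)); apply: (le_trans (osc_integral_bounded mtheta x _)).
  by apply: integrable_damped => //; exact: ltW.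
apply: le_Rintegral => //.
- by apply: integrable_norm => //; apply: integrable_damped => //; exact: ltW.
- exact: integrable_norm.
- by move=> t; rewrite /= in_itv/= andbT => t0; apply: le_damped => //; exact: ltW.
Qed.

(** It is a limit of expectations of the Poisson kernel, which is positive. *)
Lemma osc_integral_cf_ge0 (x : R) : 0 <= osc_integral theta rho x.
Proof.
have cv := cvg_damped_osc (x := x) mtheta irho.
rewrite -(cvg_lim (@Rhausdorff R) cv); apply: limr_ge; first by apply/cvg_ex; eexists; exact: cv.
apply: nearW => n; rewrite -lee_fin -damped_osc//.
apply: integral_ge0 => w _; rewrite lee_fin divr_ge0//.
by rewrite addr_ge0 ?sqr_ge0.
Qed.

Let integral_damped_osc (e a b : R) : 0 < e -> a < b ->
  (\int[mu]_(x in `[a, b]) (osc_integral theta (damped e) x)%:E =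
   \int[P]_w (atan ((b - Y w) / e) - atan ((a - Y w) / e))%:E)%E.
Proof.
move=> e0 ab.
pose k (z : T * R) := e / (e ^+ 2 + (Y z.1 - z.2) ^+ 2).
pose f (z : T * R) : \bar R := (k z * \1_(`[a, b]%classic) z.2)%:E.
have k0 z : 0 <= k z.
  by rewrite divr_ge0 ?(ltW e0)// addr_ge0 ?sqr_ge0.
have mf : measurable_fun [set: T * R] f.
  apply/measurable_EFinP; apply: measurable_funM; last first.
    apply: measurableT_comp; last exact: measurable_snd.
    by apply: measurable_indic; exact: measurable_itv.
  apply: (measurableT_comp (f := fun z : R => e / (e ^+ 2 + z ^+ 2))).
    apply: continuous_measurable_fun => z; apply: cvgM; first exact: cvg_cst.
    apply: cvgV; first by rewrite gt_eqF// ltr_pwDl ?exprn_gt0 ?sqr_ge0.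
    apply: cvgD; first exact: cvg_cst.
    by apply: cvgM; exact: cvg_id.
  apply: measurable_funB; last exact: measurable_snd.
  by apply: measurableT_comp.
have f0 z : (0 <= f z)%E by rewrite lee_fin mulr_ge0.
transitivity (\int[P]_w \int[mu]_x f (w, x))%E; last first.
  apply: eq_integral => w _; rewrite -integral_cauchy_kernel// [RHS]integral_mkcond.
  apply: eq_integral => x _; rewrite /f /k patchE/= indicE.
  by case: ifPn => _; rewrite ?mulr1 ?mulr0.
rewrite (@fubini_tonelli _ _ _ _ _ P mu f mf f0) integral_mkcond; apply: eq_integral => x _.
rewrite /f /k patchE/= indicE; case: ifPn => _; last first.
  by under eq_integral do rewrite mulr0; rewrite integral0.
by under eq_integral do rewrite mulr1; rewrite damped_osc.
Qed.

(** The damped density is integrated over [[a, b]] in two ways and the damping is removed. [L1] is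
    the limit of the integrals of the damped density, and [L2] that of the expected arctangent
    differences, which tend to [pi] times an indicator. *)
Lemma prob_itv_cf (a b : R) : a < b ->
  (P (Y @^-1` `]a, b]) =
   \int[mu]_(x in `]a, b]) (pi^-1 * osc_integral theta rho x)%:E)%E.
Proof.
move=> ab.
have mE : measurable (Y @^-1` `]a, b]) by exact: measurable_funPTI.
have cosc : continuous (osc_integral theta rho) by exact: continuous_osc_integral.
have L1 : (\int[mu]_(x in `[a, b]) (osc_integral theta (damped n.+1%:R^-1) x)%:E)%E
    @[n --> \oo] --> (\int[mu]_(x in `[a, b]) (osc_integral theta rho x)%:E)%E.
  have [] := @dominated_convergence _ _ _ mu `[a, b]%classic _
    (fun n x => (osc_integral theta (damped n.+1%:R^-1) x)%:E)
    (fun x => (osc_integral theta rho x)%:E)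
    (fun x => (\int[mu]_(t in D) `|rho t|)%:E) => //.
  - move=> n; apply/measurable_EFinP; apply: measurable_funTS.
    apply: continuous_measurable_fun; apply: continuous_osc_integral => //.
      exact: integrable_damped.
    rewrite (_ : (fun t => _) = (fun t => (expR (- (n.+1%:R^-1 * t)) * (t * rho t))%:E)); last first.
      by apply/funext => t; rewrite /damped mulrCA.
    exact: (@integrable_damped _ (fun t => t * rho t)).
  - apply/measurable_EFinP; apply: measurable_funTS.
    exact: continuous_measurable_fun.
  - apply: aeW => x _; apply: cvg_EFin; first by apply: nearW.
    exact: cvg_damped_osc.
  - apply: (@continuous_compact_integrable _ (cst _)); first exact: segment_compact.
    by apply: continuous_subspaceT => ?; exact: cvg_cst.
  - apply: aeW => x n _; rewrite lee_fin.
    apply: (le_trans (osc_integral_bounded mtheta x _)).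
      exact: integrable_damped.
    apply: le_Rintegral => //.
    + by apply: integrable_norm => //; exact: integrable_damped.
    + exact: integrable_norm.
    + by move=> t; rewrite /= in_itv/= andbT => t0; exact: le_damped.
have L2 : (\int[P]_w (atan ((b - Y w) / n.+1%:R^-1) - atan ((a - Y w) / n.+1%:R^-1))%:E)%E
    @[n --> \oo] --> (\int[P]_w (pi * \1_(`]a, b]%classic) (Y w))%:E)%E.
  have mat (c : R) n : measurable_fun [set: T] (fun w => atan ((c - Y w) / n.+1%:R^-1)).
    apply: (measurableT_comp (continuous_measurable_fun (@continuous_atan R))).
    by apply: measurable_funM => //; exact: measurable_funB.
  have [] := @dominated_convergence _ _ _ P setT _
    (fun n w => (atan ((b - Y w) / n.+1%:R^-1) - atan ((a - Y w) / n.+1%:R^-1))%:E)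
    (fun w => (pi * \1_(`]a, b]%classic) (Y w))%:E)
    (fun w => pi%:E) => //.
  - by move=> n; apply/measurable_EFinP; apply: measurable_funB; exact: mat.
  - apply/measurable_EFinP; apply: measurable_funM => //.
    exact: measurableT_comp.
  (* Pointwise convergence may fail only where [Y] hits an endpoint, a null event since [Y] has no
     atoms. *)
  - have m1 (c : R) : measurable (Y @^-1` [set c]) by exact: measurable_funPTI.
    exists (Y @^-1` [set a] `|` Y @^-1` [set b]); split.
    + exact: measurableU.
    + apply/eqP; rewrite eq_le measure_ge0 andbT.
      apply: (le_trans (measureU2 _ (m1 a) (m1 b))); rewrite -[leRHS]adde0.
      by apply: leeD; rewrite le_eqVlt; apply/orP; left; apply/eqP; exact: cf_no_atom.
    + move=> w /= nw; have [->|ya] := eqVneq (Y w) a; first by left.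
      have [->|yb] := eqVneq (Y w) b; first by right.
      exfalso; apply: nw => _; apply: cvg_EFin; first by apply: nearW.
      exact: cvg_atan_indic.
  - by apply: (@bounded_integrable _ _ _ _ (cst pi) pi) => // w; rewrite ger0_norm ?pi_ge0.
  - apply: aeW => w n _; rewrite lee_fin ler_norml.
    have := atan_gtNpi2 ((b - Y w) / n.+1%:R^-1); have := atan_ltpi2 ((b - Y w) / n.+1%:R^-1).
    have := atan_gtNpi2 ((a - Y w) / n.+1%:R^-1); have := atan_ltpi2 ((a - Y w) / n.+1%:R^-1).
    lra.
have E : (\int[mu]_(x in `[a, b]) (osc_integral theta rho x)%:E =
    \int[P]_w (pi * \1_(`]a, b]%classic) (Y w))%:E)%E.
  apply: (@cvg_unique _ _ _ _ _ _ L1 _) => //.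
  move: L2; apply: cvg_trans; apply: near_eq_cvg; apply: nearW => n.
  by rewrite integral_damped_osc.
have pi0 : (pi : R) != 0 by rewrite gt_eqF// pi_gt0.
under eq_integral do rewrite EFinM.
rewrite ge0_integralZl_EFin//; last 3 first.
- by move=> x _; rewrite lee_fin osc_integral_cf_ge0.
- apply/measurable_EFinP; apply: measurable_funTS; exact: continuous_measurable_fun.
- by rewrite invr_ge0 pi_ge0.
rewrite integral_itv_obnd_cbnd; last first.
  apply/measurable_EFinP; apply: measurable_funTS; exact: continuous_measurable_fun.
rewrite E; under eq_integral do rewrite EFinM.
rewrite ge0_integralZl_EFin ?pi_ge0//; last first.
  apply/measurable_EFinP; exact: measurableT_comp.
rewrite muleA -EFinM mulVf// mul1e.
transitivity (\int[P]_w (\1_(Y @^-1` `]a, b]) w)%:E)%E => //.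
by rewrite integral_indic// setIT.
Qed.

Theorem fourier_inversion :
  is_density P Y (fun x => pi^-1 * osc_integral theta rho x).
Proof.
apply: is_density_of_itv => [|x|]; last exact: prob_itv_cf.
  apply: measurable_funM => //; apply: continuous_measurable_fun.
  exact: continuous_osc_integral.
by rewrite mulr_ge0 ?invr_ge0 ?pi_ge0// osc_integral_cf_ge0.
Qed.

End fourier_inversion.

(** * Integrability rules for real-valued functions *)

Section real_integrable.
Context {R : realType}.
Local Notation mu := (@lebesgue_measure R).
Implicit Types (A : set R) (f h : R -> R).

Lemma Rintegrable_D A f h : measurable A ->
  mu.-integrable A (EFin \o f) -> mu.-integrable A (EFin \o h) ->
  mu.-integrable A (EFin \o (fun x => f x + h x)).
Proof. by move=> mA fi hi; exact: (@integrableD _ _ _ mu A mA _ _ fi hi). Qed.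

Lemma Rintegrable_B A f h : measurable A ->
  mu.-integrable A (EFin \o f) -> mu.-integrable A (EFin \o h) ->
  mu.-integrable A (EFin \o (fun x => f x - h x)).
Proof. by move=> mA fi hi; exact: (@integrableB _ _ _ mu A mA _ _ fi hi). Qed.

Lemma Rintegrable_Zl A f (k : R) : measurable A ->
  mu.-integrable A (EFin \o f) -> mu.-integrable A (EFin \o (fun x => k * f x)).
Proof. by move=> mA fi; exact: (@integrableZl _ _ _ mu A mA k _ fi). Qed.

Lemma Rintegrable_Zr A f (k : R) : measurable A ->
  mu.-integrable A (EFin \o f) -> mu.-integrable A (EFin \o (fun x => f x * k)).
Proof. by move=> mA fi; exact: (@integrableZr _ _ _ mu A mA k _ fi). Qed.

Lemma Rintegrable_N A f : measurable A ->
  mu.-integrable A (EFin \o f) -> mu.-integrable A (EFin \o (fun x => - f x)).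
Proof. by move=> mA fi; exact: (@integrableN _ _ _ mu A _ fi). Qed.

Lemma Rintegrable_le A f h : measurable A -> measurable_fun A f ->
  (forall x, A x -> `|f x| <= h x) ->
  mu.-integrable A (EFin \o h) -> mu.-integrable A (EFin \o f).
Proof.
move=> mA mf fh; apply: le_integrable => //; first exact/measurable_EFinP.
by move=> x Ax; rewrite /= lee_fin (le_trans (fh x Ax))// ler_norm.
Qed.

Lemma measurable_sublevel f (t : R) : measurable_fun [set: R] f ->
  measurable [set y | f y <= t].
Proof.
move=> mf; have := mf measurableT _ (measurable_itv `]-oo, t]); rewrite setTI.
by rewrite (_ : _ @^-1` _ = [set y | f y <= t]).
Qed.

Lemma EFin_Rintegral A f : measurable A -> mu.-integrable A (EFin \o f) ->
  (\int[mu]_(x in A) (f x)%:E = (\int[mu]_(x in A) f x)%:E)%E.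
Proof. by move=> mA fi; rewrite /Rintegral fineK//; exact: integrable_fin_num. Qed.

End real_integrable.

(** * Elementary inequalities for the logarithm and the weight [1 + x^2] *)

Section log_inequalities.
Context {R : realType}.
Implicit Types (t u x y : R).

Lemma ln_leB1 x : 0 < x -> ln x <= x - 1.
Proof.
move=> x0; have := @le_ln1Dx _ (x - 1); rewrite (_ : 1 + (x - 1) = x); last by ring.
by apply; lra.
Qed.

(** Pointwise form of the nonnegativity of relative entropy: [ln (u / t) <= u / t - 1] multiplied by
    [t], with [0 ln 0 = 0] at the boundary. *)
Lemma gibbs t u : 0 <= t -> 0 < u -> - (t * ln t) <= - (t * ln u) + u - t.
Proof.
move=> t0 u0; have [->|tn0] := eqVneq t 0.
  by rewrite !mul0r; lra.
have tp : 0 < t by rewrite lt0r tn0.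
have := ln_leB1 (divr_gt0 u0 tp); rewrite ln_div ?posrE// => h.
have : t * (ln u - ln t) <= t * (u / t - 1) by rewrite ler_wpM2l.
have -> : t * (u / t - 1) = u - t by field.
lra.
Qed.

Lemma oneDsqr_shift x y : `|x - y| <= 1 -> 1 + y ^+ 2 <= 3 * (1 + x ^+ 2).
Proof.
rewrite ler_norml => /andP[h1 h2].
(* The claim follows from the identity [2 + 3 x^2 - y^2 = 2 (1 - (x - y)^2) + (2 x - y)^2 + x^2]. *)
have h3 : 0 <= (1 - (x - y)) * (1 + (x - y)) by rewrite mulr_ge0//; lra.
by have := sqr_ge0 (2 * x - y); have := sqr_ge0 x; nra.
Qed.

Lemma oneDsqr_gt0 x : 0 < 1 + x ^+ 2.
Proof. by rewrite ltr_pwDl// sqr_ge0. Qed.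

End log_inequalities.

(** * Integrability of the Cauchy weight *)

Section cauchy_weight.
Context {R : realType}.
Local Notation mu := (@lebesgue_measure R).

Lemma integrable_oneDsqrV :
  mu.-integrable [set: R] (EFin \o (fun x : R => (1 + x ^+ 2)^-1)).
Proof.
have cw : continuous (fun x : R => (1 + x ^+ 2)^-1).
  move=> x; apply: cvgV; first by rewrite gt_eqF// oneDsqr_gt0.
  by apply: cvgD; [exact: cvg_cst|apply: cvgM; exact: cvg_id].
have w0 (x : R) : 0 <= (1 + x ^+ 2)^-1 by rewrite invr_ge0 ltW// oneDsqr_gt0.
apply/integrableP; split; first by apply/measurable_EFinP; exact: continuous_measurable_fun.
under eq_integral do rewrite /= ger0_norm//.
rewrite ge0_symfun_integralT//; last by move=> x; rewrite /= sqrrN.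
by rewrite -set_itvcy integral0y_oneDsqr -EFinM ltry.
Qed.

End cauchy_weight.

(** * Entropy contribution of a single cell *)

Section cell_entropy.
Context {R : realType} (g : R -> R) (L : R).
Local Notation mu := (@lebesgue_measure R).
Hypothesis g0 : forall x, 0 <= g x.
Hypothesis gL : forall x y, `|g x - g y| <= L * `|x - y|.
Hypothesis ig : mu.-integrable [set: R] (EFin \o g).
Hypothesis iell : mu.-integrable [set: R] (EFin \o (fun x => g x * ln (1 + x ^+ 2))).

Let mg : measurable_fun [set: R] g.
Proof. by apply/measurable_EFinP; exact: (measurable_int mu ig). Qed.

Let L0 : 0 <= L.
Proof.
by have := le_trans (normr_ge0 _) (gL 1 0); rewrite subr0 normr1 mulr1.
Qed.

Let mell : measurable_fun [set: R] (fun x => g x * ln (1 + x ^+ 2)).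
Proof. by apply/measurable_EFinP; exact: (measurable_int mu iell). Qed.

(** Above, [ln (g x) <= g x <= M] gives the bound [M g]. Below, Gibbs' inequality against
    [1 / (1 + x^2)] leaves the logarithmic moment plus the weight. *)
Lemma integrable_xlnx (M : R) : (forall x, g x <= M) ->
  mu.-integrable [set: R] (EFin \o (fun x => g x * ln (g x))).
Proof.
move=> gM.
apply: (@Rintegrable_le _ _ _ (fun x => M * g x + g x * ln (1 + x ^+ 2) + (1 + x ^+ 2)^-1)) => //.
- by apply: measurable_funM => //; apply: measurableT_comp => //; exact: measurable_ln.
- move=> x _; rewrite ler_norml; apply/andP; split.
    have wp : 0 < (1 + x ^+ 2)^-1 by rewrite invr_gt0 oneDsqr_gt0.
    have := gibbs (g0 x) wp; rewrite lnV ?posrE ?oneDsqr_gt0//.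
    have Mg : 0 <= M * g x by rewrite mulr_ge0// (le_trans (g0 x)).
    by have := g0 x; lra.
  have w0 : 0 <= (1 + x ^+ 2)^-1 by rewrite invr_ge0 ltW ?oneDsqr_gt0.
  have e0 : 0 <= g x * ln (1 + x ^+ 2) by rewrite mulr_ge0// ln_ge0// lerDl sqr_ge0.
  have [->|gn] := eqVneq (g x) 0; first by rewrite !mul0r mulr0 !add0r.
  have gp : 0 < g x by rewrite lt0r gn g0.
  suff : g x * ln (g x) <= M * g x by lra.
  by rewrite mulrC ler_wpM2r// (le_trans (ltW (ln_sublinear gp))).
- by apply: Rintegrable_D => //; [apply: Rintegrable_D => //; exact: Rintegrable_Zl|exact: integrable_oneDsqrV].
Qed.

(* On a cell of width [D] with mean density at least [s], the oscillation [L D]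
   of [g] costs the first term; on the other cells [g <= 2 s], and the last two
   terms come from Gibbs' inequality against the weight [e / (1 + x^2)]. *)
Definition cell_excess (D s e x : R) : R :=
  g x * (L * D / s) +
  \1_[set y | g y <= 2 * s] x * (g x * (2 - ln e + ln (1 + x ^+ 2))) +
  3 * e * (1 + x ^+ 2)^-1.

Lemma integrable_cell_excess (D s e : R) : 0 < s -> 0 <= D -> 0 < e <= 1 ->
  mu.-integrable [set: R] (EFin \o cell_excess D s e).
Proof.
move=> s0 D0 /andP[e0 e1].
have mI : measurable [set y | g y <= 2 * s] by exact: measurable_sublevel.
have i3 : mu.-integrable [set: R] (EFin \o (fun x => g x * (2 - ln e + ln (1 + x ^+ 2)))).
  apply: (@eq_integrable _ _ _ mu _ _ (EFin \o (fun x => (2 - ln e) * g x + g x * ln (1 + x ^+ 2)))) => //.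
    by move=> x _ /=; congr EFin; ring.
  by apply: Rintegrable_D => //; exact: Rintegrable_Zl.
apply: Rintegrable_D => //.
  apply: Rintegrable_D => //.
    apply: (@eq_integrable _ _ _ mu _ _ (EFin \o (fun x => (L * D / s) * g x))) => //.
      by move=> x _ /=; congr EFin; ring.
    exact: Rintegrable_Zl.
  apply: (@Rintegrable_le _ _ _ (fun x => g x * (2 - ln e + ln (1 + x ^+ 2)))) => //.
    apply: measurable_funM; first exact: measurable_indic.
    by apply/measurable_EFinP; exact: (measurable_int mu i3).
  move=> x _; have h0 : 0 <= g x * (2 - ln e + ln (1 + x ^+ 2)).
    rewrite mulr_ge0// addr_ge0 ?ln_ge0 ?lerDl ?sqr_ge0//.
    by have := ln_le0 e1; lra.
  by rewrite normrM (ger0_norm h0) ler_piMl// indicE; case: (_ \in _); rewrite ?normr1 ?normr0.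
by apply: Rintegrable_Zl => //; exact: integrable_oneDsqrV.
Qed.

Section one_cell.
Context (a D : R).
Hypothesis D0 : 0 < D.
Let A : set R := `[a, a + D[%classic.
Let p : R := (\int[mu]_(x in A) g x)%R.
Hypothesis igl : mu.-integrable [set: R] (EFin \o (fun x => g x * ln (g x))).

Let mA : measurable A. Proof. exact: measurable_itv. Qed.

Let muA : mu A = D%:E.
Proof. by rewrite lebesgue_measure_itv/= lte_fin ltrDl D0 -EFinB addrAC subrr add0r. Qed.

Let intA f : mu.-integrable [set: R] (EFin \o f) -> mu.-integrable A (EFin \o f).
Proof. by move=> fi; apply: (integrableS _ _ _ fi). Qed.

Let int_cst (c : R) : mu.-integrable A (EFin \o (fun=> c)).
Proof.
apply: measurable_bounded_integrable => //; first by rewrite [X in (X < _)%E]muA ltry.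
by exists `|c|; split; [exact: num_real|move=> M cM x _; exact: ltW].
Qed.

Let Rint_cst (c : R) : (\int[mu]_(x in A) c)%R = c * D.
Proof. by rewrite Rintegral_cst// [X in fine X]muA. Qed.

Let p0 : 0 <= p.
Proof. by apply: Rintegral_ge0 => x _. Qed.

Let cell_diff x y : A x -> A y -> g x - g y <= L * D.
Proof.
rewrite /A /= !in_itv/= => /andP[ax xb] /andP[ay yb].
rewrite (le_trans (ler_norm _))// (le_trans (gL _ _))// ler_wpM2l//.
by rewrite ler_norml; apply/andP; split; lra.
Qed.

Let cell_mean x : A x -> `|g x - p / D| <= L * D.
Proof.
move=> Ax; have DV : 0 < D^-1 by rewrite invr_gt0.
have h1 : (g x - L * D) * D <= p.
  rewrite -Rint_cst; apply: le_Rintegral => //; try exact: intA.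
  by move=> y Ay; have := cell_diff Ax Ay; lra.
have h2 : p <= (g x + L * D) * D.
  rewrite -Rint_cst; apply: le_Rintegral => //; try exact: intA.
  by move=> y Ay; have := cell_diff Ay Ax; lra.
rewrite -ler_pdivlMr// in h1; rewrite -ler_pdivrMr// in h2.
by rewrite ler_norml; apply/andP; split; lra.
Qed.

(** This is [- g ln (g D)]: when [g] has integral [1], its integrals over a partition into cells add
    up to [diff_entropy g - ln D]. *)
Let F x : R := - (g x * ln (g x)) - g x * ln D.

Let iF : mu.-integrable A (EFin \o F).
Proof.
apply: intA; apply: Rintegrable_B => //; first exact: Rintegrable_N.
apply: (@eq_integrable _ _ _ mu _ _ (EFin \o (fun x => ln D * g x))) => //.
  by move=> x _ /=; congr EFin; ring.
exact: Rintegrable_Zl.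
Qed.

Let int_affine (c k : R) : (\int[mu]_(x in A) (g x * c + k))%R = p * c + k * D.
Proof.
rewrite RintegralD//; last by apply: Rintegrable_Zr => //; exact: intA.
by rewrite RintegralZr ?Rint_cst//; exact: intA.
Qed.

(** Gibbs' inequality against a constant [u], integrated over the cell, is sharpest at the mean
    density [u = p / D]. For [p = 0] this is not positive, and [u = e / D] with arbitrarily small
    [e] replaces it. *)
Lemma cell_entropy_ge : (\int[mu]_(x in A) F x)%R <= - (p * ln p).
Proof.
have H u : 0 < u -> (\int[mu]_(x in A) F x)%R <= p * (- ln u - 1 - ln D) + u * D.
  move=> u0; rewrite -int_affine; apply: le_Rintegral => //.
    by apply: Rintegrable_D => //; apply: Rintegrable_Zr => //; exact: intA.
  by move=> x _; have := gibbs (g0 x) u0; rewrite /F; lra.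
have [pz|pn] := eqVneq p 0.
  rewrite pz mul0r oppr0; apply/ler_addgt0Pr => e e0; rewrite add0r.
  have := H (e / D); rewrite pz mul0r add0r divfK ?gt_eqF//; apply.
  exact: divr_gt0.
have pp : 0 < p by rewrite lt0r pn p0.
have := H _ (divr_gt0 pp D0); rewrite divfK ?gt_eqF// ln_div ?posrE//; lra.
Qed.

Let int_aff (c k : R) : mu.-integrable A (EFin \o (fun x => g x * c + k)).
Proof. by apply: Rintegrable_D => //; apply: Rintegrable_Zr => //; exact: intA. Qed.

Let pln : p * ln p = p * ln (p / D) + p * ln D.
Proof.
have [->|pn] := eqVneq p 0; first by rewrite !mul0r addr0.
have pp : 0 < p by rewrite lt0r pn p0.
by rewrite ln_div ?posrE// mulrBr subrK.
Qed.

(** The cases are whether the mean density [p / D] reaches [s]. In each, [- p ln p] is bounded by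
    the integral of an affine function of [g], which is then compared pointwise with
    [F + cell_excess]. *)
Lemma cell_entropy_le (s e : R) : 0 < e <= 1 -> L * D <= s -> 2 * s <= 1 ->
  0 < s -> D <= 1 ->
  - (p * ln p) <= (\int[mu]_(x in A) (F x + cell_excess D s e x))%R.
Proof.
move=> /andP[e0 e1] LDs s1 s0 D1.
have iX : mu.-integrable A (EFin \o (fun x => F x + cell_excess D s e x)).
  apply: Rintegrable_D => //; apply: intA.
  by apply: integrable_cell_excess; rewrite ?(ltW D0)// e0.
have lne : ln e <= 0 by exact: ln_le0.
have [st|ts] := leP s (p / D).
  have tp : 0 < p / D by exact: lt_le_trans st.
  have -> : - (p * ln p) = p * (- ln (p / D) - ln D) + 0 * D by rewrite pln; ring.
  rewrite -int_affine; apply: le_Rintegral => // x Ax.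
  have Ex : 0 <= \1_[set y | g y <= 2 * s] x * (g x * (2 - ln e + ln (1 + x ^+ 2))).
    rewrite mulr_ge0 ?indicE//; apply: mulr_ge0 => //; apply: addr_ge0; first by lra.
    by rewrite ln_ge0// lerDl sqr_ge0.
  have Wx : 0 <= 3 * e * (1 + x ^+ 2)^-1.
    by rewrite mulr_ge0 ?mulr_ge0 ?(ltW e0)// invr_ge0 ltW// oneDsqr_gt0.
  (* Dense cell: [ln (g / (p / D))] is at most the relative deviation of [g] from its mean, hence at
     most [L D / s]; the other two terms of the excess are nonnegative. *)
  suff : g x * (ln (g x) - ln (p / D)) <= g x * (L * D / s).
    by rewrite /cell_excess /F; lra.
  have [->|gn] := eqVneq (g x) 0; first by rewrite !mul0r.
  have gp : 0 < g x by rewrite lt0r gn g0.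
  rewrite ler_wpM2l// -ln_div ?posrE// (le_trans (ln_leB1 (divr_gt0 gp tp)))//.
  have -> : g x / (p / D) - 1 = (g x - p / D) / (p / D).
    by rewrite mulrBl divff ?gt_eqF.
  rewrite (@le_trans _ _ (L * D / (p / D)))//.
    rewrite ler_wpM2r ?invr_ge0 ?(ltW tp)//.
    by rewrite (le_trans (ler_norm _))// cell_mean.
  by rewrite ler_wpM2l ?mulr_ge0 ?(ltW D0)// lef_pV2 ?posrE.
(* Sparse cell: the weight is frozen at the left endpoint [a], so that Gibbs' inequality can be
   applied to the mean density; it is compared with the weight at [x] afterwards. *)
pose u := e / (1 + a ^+ 2).
have u0 : 0 < u by rewrite divr_gt0 ?oneDsqr_gt0.
have t0 : 0 <= p / D by rewrite divr_ge0 ?(ltW D0).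
have lnu : ln u = ln e - ln (1 + a ^+ 2) by rewrite ln_div ?posrE ?oneDsqr_gt0.
have h1 : - (p * ln (p / D)) <= - (p * ln u) + u * D.
  have gt : - (p / D * ln (p / D)) <= - (p / D * ln u) + u.
    by have := gibbs t0 u0; lra.
  have := ler_wpM2r (ltW D0) gt.
  have -> : - (p / D * ln (p / D)) * D = - (p * ln (p / D)).
    by rewrite mulNr mulrAC divfK ?gt_eqF.
  have -> // : (- (p / D * ln u) + u) * D = - (p * ln u) + u * D.
  by rewrite mulrDl mulNr mulrAC divfK ?gt_eqF.
rewrite (@le_trans _ _ (p * (- ln u - ln D) + u * D))//; first by rewrite pln; lra.
rewrite -int_affine; apply: le_Rintegral => // x Ax.
(* The mean is below [s] and [g] deviates from it by at most [L D <= s]. Since [2 s <= 1], the term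
   [- g ln g] in [F] is then nonnegative. *)
have gx : g x <= 2 * s by have := cell_mean Ax; rewrite ler_norml => /andP[_]; lra.
have gl0 : g x * ln (g x) <= 0 by rewrite mulr_ge0_le0// ln_le0//; lra.
have xa : `|x - a| <= 1.
  by move: Ax; rewrite /A/= in_itv/= => /andP[? ?]; rewrite ler_norml; apply/andP; split; lra.
(* Moving the weight from [a] to [x] costs a factor [3]; the bound [ln 3 <= 2] is the source of the
   constant [2] in [cell_excess]. *)
have la : ln (1 + a ^+ 2) <= 2 + ln (1 + x ^+ 2).
  have ln3 : ln (3 : R) <= 2 by rewrite (le_trans (ln_leB1 _))//; lra.
  rewrite (@le_trans _ _ (ln 3 + ln (1 + x ^+ 2)))//; last by rewrite lerD2r.
  rewrite -lnM ?posrE ?oneDsqr_gt0// ler_ln ?posrE ?mulr_gt0 ?oneDsqr_gt0//.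
  exact: oneDsqr_shift.
have ua : u <= 3 * e * (1 + x ^+ 2)^-1.
  rewrite /u (mulrC 3) -mulrA ler_wpM2l ?(ltW e0)//.
  rewrite -[leRHS]invrK invfM invrK lef_pV2 ?posrE ?oneDsqr_gt0 ?mulr_gt0 ?invr_gt0 ?oneDsqr_gt0//.
  rewrite mulrC ler_pdivrMr// mulrC; apply: oneDsqr_shift.
  by rewrite distrC.
have h2 : g x * (- ln u) <= g x * (2 - ln e + ln (1 + x ^+ 2)).
  by rewrite ler_wpM2l// lnu; lra.
have h3 : 0 <= g x * (L * D / s).
  by rewrite mulr_ge0// divr_ge0 ?(ltW s0)// mulr_ge0 ?(ltW D0).
rewrite /cell_excess /F indicE mem_set// mul1r; lra.
Qed.

End one_cell.

End cell_entropy.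

(** * Partition of the line into cells and the entropy of a quantized variable *)

Section cells.
Context {R : realType}.

(** Turns the integer-indexed cells into a sequence, so that countable additivity and series over
    [nat] apply. *)
Definition int_enum (n : nat) : int := if odd n then Negz n./2 else Posz n./2.

Lemma int_enum_bij : set_bij [set: nat] [set: int] int_enum.
Proof.
split => //.
- move=> m n _ _; rewrite /int_enum.
  have := odd_double_half m; have := odd_double_half n.
  by case: (odd m) (odd n) => [] [] // nE mE [mn]; rewrite -mE -nE mn.
- case=> k _ /=.
    by exists k.*2 => //; rewrite /int_enum odd_double doubleK.
  exists k.*2.+1 => //; rewrite /int_enum /= odd_double /=.
  by rewrite uphalf_double.
Qed.

Definition cell (c D : R) (k : int) : set R :=
  `[c + k%:~R * D, c + k%:~R * D + D[%classic.

Lemma measurable_cell c D k : measurable (cell c D k).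
Proof. exact: measurable_itv. Qed.

Lemma cellP (c D : R) (k : int) (x : R) : 0 < D ->
  cell c D k x <-> Num.floor ((x - c) / D) = k.
Proof.
move=> D0; rewrite /cell /= in_itv/=; split=> [/andP[h1 h2]|<-].
  apply: floor_def; rewrite ler_pdivlMr// ltr_pdivrMr// intrD mulrDl mul1r.
  by apply/andP; split; lra.
have /andP[] := floor_itv ((x - c) / D); set k' := Num.floor _.
rewrite ler_pdivlMr// ltr_pdivrMr// intrD mulrDl mul1r => h1 h2.
by apply/andP; split; lra.
Qed.

Lemma bigcup_cell (c D : R) : 0 < D -> \bigcup_n cell c D (int_enum n) = [set: R].
Proof.
move=> D0; apply/seteqP; split => // x _.
have [_ _ /(_ (Num.floor ((x - c) / D)) I)[n _ nE]] := int_enum_bij.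
by exists n => //; apply/cellP.
Qed.

Lemma trivIset_cell (c D : R) : 0 < D ->
  trivIset [set: nat] (fun n => cell c D (int_enum n)).
Proof.
move=> D0; apply/trivIsetP => m n _ _ mn; apply/seteqP; split => // x [].
move=> /(cellP _ _ _ D0) h1 /(cellP _ _ _ D0) h2.
have [_ inj _] := int_enum_bij.
by move/eqP : mn; apply; apply: inj; rewrite ?inE// -h1 -h2.
Qed.

(* Only the values [f k] have positive probability, so the sum over all reals
   reduces to a sum over the cells. *)
Lemma discrete_entropy_cells (d : measure_display) (T : measurableType d)
    (P : probability T R) (Q Z : T -> R) (c D : R) (f : int -> R) :
  0 < D -> injective f -> (forall w, Q w = f (Num.floor ((Z w - c) / D))) ->
  let p n := fine (P (Z @^-1` cell c D (int_enum n))) in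
  (forall n, 0 <= - (p n * ln (p n))) ->
  discrete_entropy P Q = (\sum_(n <oo) (- (p n * ln (p n)))%:E)%E.
Proof.
move=> D0 finj QE p p0; rewrite /discrete_entropy.
have preE k : Q @^-1` [set f k] = Z @^-1` cell c D k.
  apply/seteqP; split => w /=; rewrite QE.
    by move=> /finj h; apply/cellP.
  by move=> /(cellP _ _ _ D0) ->.
have ginj : set_inj [set: nat] (f \o int_enum).
  move=> m n _ _ /= /finj; have [_ inj _] := int_enum_bij; apply: inj; rewrite inE//.
transitivity (\esum_(y in (f \o int_enum) @` [set: nat])
    (let p := fine (P (Q @^-1` [set y])) in (- (p * ln p))%:E))%E.
  rewrite [RHS]esum_mkcond; apply: eq_esum => y _.
  case: ifPn => //; rewrite notin_setE => ny.
  rewrite (_ : Q @^-1` [set y] = set0) ?measure0 ?mul0r ?oppr0//.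
  apply/seteqP; split => // w /= Qw; apply: ny.
  have [_ _ /(_ (Num.floor ((Z w - c) / D)) I)[n _ nE]] := int_enum_bij.
  by exists n => //=; rewrite nE -QE.
rewrite esum_image//= nneseries_esumT; last by move=> n; rewrite lee_fin.
by apply: eq_esum => n _ /=; rewrite preE.
Qed.

End cells.

(** * Entropy of a finely quantized variable, uniformly in the offset *)

Section quantized_entropy.
Context {R : realType} (g : R -> R) (L M : R).
Local Notation mu := (@lebesgue_measure R).
Hypothesis g0 : forall x, 0 <= g x.
Hypothesis gM : forall x, g x <= M.
Hypothesis gL : forall x y, `|g x - g y| <= L * `|x - y|.
Hypothesis ig : mu.-integrable [set: R] (EFin \o g).
Hypothesis iell : mu.-integrable [set: R] (EFin \o (fun x => g x * ln (1 + x ^+ 2))).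

Let igl : mu.-integrable [set: R] (EFin \o (fun x => g x * ln (g x))).
Proof. exact: (integrable_xlnx g0 ig iell gM). Qed.

Let M0 : 0 <= M. Proof. exact: le_trans (g0 0) (gM 0). Qed.

Let L0 : 0 <= L.
Proof.
by have := le_trans (normr_ge0 _) (gL 1 0); rewrite subr0 normr1 mulr1.
Qed.

Let mg : measurable_fun [set: R] g.
Proof. by apply/measurable_EFinP; exact: (measurable_int mu ig). Qed.

Lemma cell_excess_ge0 (D s e x : R) : 0 < s -> 0 <= D -> 0 < e <= 1 ->
  0 <= cell_excess g L D s e x.
Proof.
move=> s0 D0 /andP[e0 e1]; have lne : ln e <= 0 by exact: ln_le0.
rewrite /cell_excess; apply: addr_ge0; first apply: addr_ge0.
- by rewrite mulr_ge0// divr_ge0 ?(ltW s0)// mulr_ge0.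
- rewrite mulr_ge0 ?indicE//; apply: mulr_ge0 => //; apply: addr_ge0; first by lra.
  by rewrite ln_ge0// lerDl sqr_ge0.
- by rewrite mulr_ge0 ?mulr_ge0 ?(ltW e0)// invr_ge0 ltW// oneDsqr_gt0.
Qed.

(** Sums the two one-cell bounds over the partition. The offset [c] is absent from both sides, which
    makes the estimate uniform in it. *)
Lemma discrete_entropy_bounds (d : measure_display) (T : measurableType d)
    (P : probability T R) (Q : T -> R) (Z : {RV P >-> R}) (c D s e : R)
    (f : int -> R) : is_density P Z g ->
  injective f -> (forall w, Q w = f (Num.floor ((Z w - c) / D))) ->
  0 < D -> D <= 1 -> M * D <= 1 -> 0 < e <= 1 -> 0 < s -> 2 * s <= 1 -> L * D <= s ->
  ((diff_entropy g - ln D)%:E <= discrete_entropy P Q <=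
   (diff_entropy g - ln D + \int[mu]_x cell_excess g L D s e x)%:E)%E.
Proof.
move=> [_ [_ gP]] finj QE D0 D1 MD e01 s0 s1 LDs.
pose F x : R := - (g x * ln (g x)) - g x * ln D.
pose C n := cell c D (int_enum n).
pose p n := fine (P (Z @^-1` C n)).
have mC n : measurable (C n) by exact: measurable_cell.
have pE n : p n = (\int[mu]_(x in C n) g x)%R by rewrite /p gP.
have p01 n : 0 <= - (p n * ln (p n)).
  have mZ : measurable (Z @^-1` C n) by exact: measurable_funPTI.
  rewrite oppr_ge0 mulr_ge0_le0 ?fine_ge0// ln_le0// -lee_fin fineK ?probability_le1//.
  exact: fin_num_measure.
rewrite (discrete_entropy_cells (Z := Z) D0 finj QE)//.
have iF : mu.-integrable [set: R] (EFin \o F).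
  apply: Rintegrable_B => //; first exact: Rintegrable_N.
  exact: Rintegrable_Zr.
have iX : mu.-integrable [set: R] (EFin \o cell_excess g L D s e).
  by apply: integrable_cell_excess => //; exact: ltW.
(* [M D <= 1] gives [g D <= 1], so [F = - g ln (g D)] is nonnegative and its cell integrals can be
   summed as a nonnegative series. *)
have F0 x : 0 <= F x.
  have [gz|gn] := eqVneq (g x) 0; first by rewrite /F gz !mul0r subr0 oppr0.
  have gp : 0 < g x by rewrite lt0r gn g0.
  rewrite /F -opprD -mulrDr -lnM ?posrE// oppr_ge0 mulr_ge0_le0// ln_le0//.
  by apply: le_trans MD; rewrite ler_wpM2r// ltW.
have X0 x : 0 <= cell_excess g L D s e x.
  by apply: cell_excess_ge0 => //; exact: ltW.
have sumC (h : R -> R) : mu.-integrable [set: R] (EFin \o h) -> (forall x, 0 <= h x) ->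
    (\sum_(n <oo) (\int[mu]_(x in C n) h x)%:E = (\int[mu]_x h x)%:E)%E.
  move=> ih h0; rewrite -EFin_Rintegral// -(bigcup_cell c D0) ge0_integral_bigcup//.
  - apply: eq_eseriesr => n _; rewrite EFin_Rintegral//; first exact: mC.
    by apply: (integrableS _ _ _ ih) => //; exact: mC.
  - by rewrite bigcup_cell//; exact: (measurable_int mu ih).
  - by move=> x _; rewrite lee_fin.
  - exact: trivIset_cell.
have g1 : (\int[mu]_x g x)%R = 1.
  by rewrite /Rintegral -gP// preimage_setT probability_setT.
have FE : (\int[mu]_x F x)%R = diff_entropy g - ln D.
  rewrite RintegralB//; [|exact: Rintegrable_N|exact: Rintegrable_Zr].
  rewrite RintegralZr// g1 mul1r; congr (_ - _).
  rewrite /diff_entropy -mulN1r -RintegralZl//.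
  by apply: eq_Rintegral => x _; rewrite mulN1r.
apply/andP; split.
  rewrite -FE -sumC//; apply: lee_nneseries => [n _ _|n _].
    by rewrite lee_fin Rintegral_ge0.
  by rewrite lee_fin -/(C n) -/(p n) pE; exact: cell_entropy_ge.
rewrite -FE -RintegralD// -sumC; last 2 first.
- exact: Rintegrable_D.
- by move=> x; rewrite addr_ge0.
apply: lee_nneseries => [n _ _|n _]; first by rewrite lee_fin; exact: p01.
by rewrite lee_fin -/(C n) -/(p n) pE; exact: cell_entropy_le.
Qed.

Hypothesis g1 : (\int[mu]_x g x)%R = 1.

Lemma cell_excess_small (eps : R) : 0 < eps -> exists e s D0 : R,
  [/\ 0 < e <= 1, 0 < s, 2 * s <= 1 & 0 < D0 <= 1] /\
  [/\ L * D0 <= s, M * D0 <= 1 & forall D, 0 < D <= D0 ->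
  (\int[mu]_x cell_excess g L D s e x)%R <= eps].
Proof.
move=> eps0.
pose W := (\int[mu]_x (1 + x ^+ 2)^-1)%R.
have W0 : 0 <= W by apply: Rintegral_ge0 => x _; rewrite invr_ge0 ltW// oneDsqr_gt0.
pose e := Num.min 1 (eps / (9 * (W + 1))).
have W1 : 0 < 9 * (W + 1) by lra.
have e0 : 0 < e by rewrite lt_min ltr01 divr_gt0.
have e1 : e <= 1 by rewrite ge_min lexx.
have eW : 3 * e * W <= eps / 3.
  have : e <= eps / (9 * (W + 1)) by rewrite ge_min lexx orbT.
  by rewrite ler_pdivlMr//; have := e0; nra.
have lne : ln e <= 0 by exact: ln_le0.
pose q x := g x * (2 - ln e + ln (1 + x ^+ 2)).
have q0 x : 0 <= q x.
  apply: mulr_ge0 => //; apply: addr_ge0; first by lra.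
  by rewrite ln_ge0// lerDl sqr_ge0.
have iq : mu.-integrable [set: R] (EFin \o q).
  apply: (@eq_integrable _ _ _ mu _ _ (EFin \o (fun x => (2 - ln e) * g x + g x * ln (1 + x ^+ 2)))) => //.
    by move=> x _ /=; congr EFin; rewrite /q; ring.
  by apply: Rintegrable_D => //; exact: Rintegrable_Zl.
have mI (t : R) : measurable [set y | g y <= t] by exact: measurable_sublevel.
have mq : measurable_fun [set: R] q.
  by apply/measurable_EFinP; exact: (measurable_int mu iq).
pose Iq (t : R) := (\int[mu]_x (\1_[set y | g y <= t] x * q x))%R.
have iIq t : mu.-integrable [set: R] (EFin \o (fun x => \1_[set y | g y <= t] x * q x)).
  apply: (@Rintegrable_le _ _ _ q) => //.
    by apply: measurable_funM => //; exact: measurable_indic.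
  move=> x _; rewrite normrM (ger0_norm (q0 x)) ler_piMl// indicE.
  by case: (_ \in _); rewrite ?normr1 ?normr0.
(* As the threshold decreases to [0], the set [g <= t] shrinks to [g = 0], where [q] vanishes; [q]
   itself is the majorant. *)
have Icvg : Iq n.+2%:R^-1 @[n --> \oo] --> (0 : R).
  rewrite -[X in _ --> X](_ : fine 0%E = 0)//; apply: fine_cvg.
  rewrite -[X in _ --> X](@integral0 _ _ _ mu [set: R]).
  have [] := @dominated_convergence _ _ _ mu [set: R] _
    (fun n x => (\1_[set y | g y <= n.+2%:R^-1] x * q x)%:E) (cst 0%E)
    (fun x => (q x)%:E) => //.
  - by move=> n; exact: (measurable_int mu (iIq _)).
  - apply: aeW => x _; apply: cvg_near_cst.
    have [gz|gn] := eqVneq (g x) 0.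
      by apply: nearW => n; rewrite /q gz mul0r mulr0.
    have gp : 0 < g x by rewrite lt0r gn g0.
    near=> n; rewrite indicE memNset ?mul0r//=; apply/negP; rewrite -ltNge.
    rewrite invf_plt ?posrE//.
    rewrite (@lt_le_trans _ _ n%:R)//; last by rewrite ler_nat; apply: leqW; apply: leqW.
    by near: n; exact: nbhs_infty_gtr.
  - apply: aeW => x n _; rewrite lee_fin normrM (ger0_norm (q0 x)) ler_piMl// indicE.
    by case: (_ \in _); rewrite ?normr1 ?normr0.
have [n Hn] : exists n, Iq n.+2%:R^-1 <= eps / 3.
  have e3 : 0 < eps / 3 by rewrite divr_gt0.
  have [n _ Hn] := cvgr_le _ Icvg _ e3.
  by exists n; exact: (Hn n (leqnn n)).
pose s : R := n.+2%:R^-1 / 2.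
have s2 : 2 * s = n.+2%:R^-1 by rewrite /s mulrCA divff ?mulr1.
have s0 : 0 < s by rewrite divr_gt0 ?invr_gt0.
(* The three entries give [D0 <= 1], [M D0 <= 1], and [L D0] at most both [s] and [s eps / 3]; the
   added ones keep the denominators positive. *)
pose D0 := Num.min 1 (Num.min (M + 1)^-1 (s * Num.min 1 (eps / 3) / (L + 1))).
have m0 : 0 < Num.min 1 (eps / 3) by rewrite lt_min ltr01 divr_gt0.
have D00 : 0 < D0.
  by rewrite !lt_min ltr01 invr_gt0 ltr_wpDl//= divr_gt0 ?mulr_gt0// ltr_wpDl.
have LD : L * D0 <= s * Num.min 1 (eps / 3).
  have : D0 <= s * Num.min 1 (eps / 3) / (L + 1) by rewrite !ge_min lexx !orbT.
  by rewrite ler_pdivlMr ?ltr_wpDl//; lra.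
exists e, s, D0; split; split => //.
- by rewrite e0.
- by rewrite s2 invf_le1// ler1n.
- by rewrite D00 ge_min lexx.
- by apply: (le_trans LD); rewrite ler_piMr ?(ltW s0)// ge_min lexx.
- have : D0 <= (M + 1)^-1 by rewrite !ge_min lexx !orbT.
  by rewrite -[_^-1]mul1r ler_pdivlMr ?ltr_wpDl//; lra.
move=> D /andP[Dp DD0].
have i1 := Rintegrable_Zr (L * D / s) measurableT ig.
have i3 := Rintegrable_Zl (3 * e) measurableT (@integrable_oneDsqrV R).
have i2 := iIq (2 * s).
rewrite /cell_excess (RintegralD measurableT (Rintegrable_D measurableT i1 i2) i3).
rewrite (RintegralD measurableT i1 i2).
rewrite (RintegralZr _ measurableT ig) (RintegralZl _ measurableT (@integrable_oneDsqrV R)).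
rewrite g1 mul1r -/W s2 -/(Iq _).
suff : L * D / s <= eps / 3 by lra.
rewrite ler_pdivrMr// [leRHS]mulrC (@le_trans _ _ (L * D0))// ?ler_wpM2l//.
by apply: (le_trans LD); rewrite ler_wpM2l ?(ltW s0)// ge_min lexx orbT.
Unshelve. all: by end_near. Qed.

(** [D0] is chosen before the variable, the offset and the width: in the application [Z] and [c]
    change with [n] while only the density stays fixed. *)
Lemma quantized_entropy (d : measure_display) (T : measurableType d)
    (P : probability T R) (eps : R) : 0 < eps -> exists2 D0 : R, 0 < D0 &
  forall (Q : T -> R) (Z : {RV P >-> R}) (c D : R) (f : int -> R),
    is_density P Z g -> injective f ->
    (forall w, Q w = f (Num.floor ((Z w - c) / D))) -> 0 < D <= D0 ->
    ((diff_entropy g - ln D)%:E <= discrete_entropy P Q <=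
     (diff_entropy g - ln D + eps)%:E)%E.
Proof.
move=> /cell_excess_small[e [s [D0 [[e01 s0 s1 /andP[D00 D01]] [LD MD H]]]]].
exists D0 => // Q Z c D f gZ finj QE /andP[Dp DD0].
have /andP[h1 h2] : ((diff_entropy g - ln D)%:E <= discrete_entropy P Q <=
   (diff_entropy g - ln D + \int[mu]_x cell_excess g L D s e x)%:E)%E.
  apply: (discrete_entropy_bounds gZ finj QE) => //.
  - exact: le_trans DD0 D01.
  - by apply: le_trans MD; rewrite ler_wpM2l.
  - by apply: le_trans LD; rewrite ler_wpM2l.
by rewrite h1 (le_trans h2)// lee_fin lerD2l H// Dp.
Qed.

End quantized_entropy.

(** * Logarithmic moment from the characteristic function near the origin *)

Section log_moment.
Context {R : realType}.
Local Notation mu := (@lebesgue_measure R).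

Lemma geometric_sum_le (q : R) (N : nat) : 0 <= q < 1 ->
  \sum_(0 <= i < N) q ^+ i <= (1 - q)^-1.
Proof.
move=> /andP[q0 q1].
have h : (1 - q) * \sum_(0 <= i < N) q ^+ i = 1 - q ^+ N.
  elim: N => [|N IH]; first by rewrite big_geq// mulr0 expr0 subrr.
  by rewrite big_nat_recr//= mulrDr IH exprS; ring.
rewrite -[leRHS]mul1r ler_pdivlMr ?subr_gt0// mulrC h.
by rewrite gerBl exprn_ge0.
Qed.

(** With [q] the fourth root of [r], the general term is [((n + 1) q^n)^2 (q^2)^n]. Each of the
    [n + 1] powers up to [q^n] is at least [q^n], so [(n + 1) q^n] is at most [1 / (1 - q)], and a
    geometric series remains. *)
Lemma sqr_geometric_sum_le (r : R) : 0 < r < 1 ->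
  exists K, forall N, \sum_(0 <= n < N) n.+1%:R ^+ 2 * r ^+ n <= K.
Proof.
move=> /andP[r0 r1].
pose q := Num.sqrt (Num.sqrt r).
have q0 : 0 <= q by exact: sqrtr_ge0.
have q4 : q ^+ 4 = r.
  by rewrite (exprM q 2 2) sqr_sqrtr ?sqrtr_ge0// sqr_sqrtr// ltW.
have q1 : q < 1.
  rewrite ltNge; apply/negP => qge; move: r1; rewrite -q4 ltNge => /negP; apply.
  exact: exprn_ege1.
have q01 : 0 <= q < 1 by rewrite q0.
have q21 : 0 <= q ^+ 2 < 1 by rewrite sqr_ge0 exprn_ilt1.
have nq n : n.+1%:R * q ^+ n <= (1 - q)^-1.
  apply: le_trans (geometric_sum_le n.+1 q01).
  rewrite mulr_natl -[in leLHS](subn0 n.+1) -sumr_const_nat !big_nat.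
  apply: ler_sum => i /andP[_ iN].
  by apply: ler_wiXn2l; [exact: q0|exact: ltW|rewrite -ltnS].
exists ((1 - q)^-1 ^+ 2 * (1 - q ^+ 2)^-1) => N.
have H n : n.+1%:R ^+ 2 * r ^+ n <= (1 - q)^-1 ^+ 2 * (q ^+ 2) ^+ n.
  have -> : n.+1%:R ^+ 2 * r ^+ n = (n.+1%:R * q ^+ n) ^+ 2 * (q ^+ 2) ^+ n.
    rewrite -q4 (_ : q ^+ 4 = q ^+ 2 * q ^+ 2); last by rewrite -exprD.
    have -> : (q ^+ 2 * q ^+ 2) ^+ n = (q ^+ n) ^+ 2 * (q ^+ 2) ^+ n.
      by rewrite [LHS]exprMn (exprAC q n 2).
    by rewrite mulrA -[in LHS]exprMn.
  rewrite ler_wpM2r ?exprn_ge0// lerXn2r// nnegrE ?mulr_ge0 ?exprn_ge0//.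
  by rewrite invr_ge0 subr_ge0 ltW.
apply: (le_trans (ler_sum _ (fun n _ => H n))).
rewrite -mulr_sumr ler_wpM2l ?exprn_ge0 ?invr_ge0 ?subr_ge0 ?(ltW q1)//.
exact: geometric_sum_le.
Qed.

Lemma dyadic_scale (x : R) : 1 <= x -> exists n : nat, 2 ^+ n <= x < 2 ^+ n.+1.
Proof.
move=> x1.
have ex : exists n, x < 2 ^+ n by exists (Num.Def.archi_bound x); exact: upper_nthrootP.
case: (ex_minnP ex) => -[|n] xn nmin; first by move: xn; rewrite expr0 ltNge x1.
exists n; rewrite xn andbT leNgt; apply/negP => /nmin.
by rewrite ltnn.
Qed.

Definition annulus (n : nat) : set R := [set x | 2 ^+ n <= `|x| < 2 ^+ n.+1].

Lemma measurable_annulus n : measurable (annulus n).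
Proof.
have := (@normr_measurable R setT) measurableT _ (measurable_itv `[(2 ^+ n : R), 2 ^+ n.+1[).
by rewrite setTI; congr (measurable _); apply/seteqP; split => x; rewrite /annulus/= in_itv.
Qed.

(** Here [1 + x^2 <= 4^(n + 2)] and [ln 4 <= 3], and [3 (n + 2) <= 6 (n + 1)]. *)
Lemma ln_annulus n x : annulus n x -> ln (1 + x ^+ 2) <= 6 * n.+1%:R.
Proof.
move=> /andP[_ xn].
have x4 : x ^+ 2 <= 4 ^+ n.+1.
  rewrite -real_normK ?num_real// (_ : 4 = 2 ^+ 2); last by rewrite -natrX.
  by rewrite -exprM mulnC exprM lerXn2r ?nnegrE// ltW.
have h : 1 + x ^+ 2 <= 4 ^+ n.+2.
  have : (1 : R) <= 4 ^+ n.+1 by rewrite exprn_ege1// ler1n.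
  by rewrite (exprS _ n.+1); lra.
rewrite (@le_trans _ _ (ln (4 ^+ n.+2)))//.
  by rewrite ler_ln ?posrE ?oneDsqr_gt0 ?exprn_gt0.
rewrite lnXn// -[X in X <= _]mulr_natr.
have ln4 : ln (4 : R) <= 3 by rewrite (le_trans (ln_leB1 _))//; lra.
have n0 : (0 : R) <= n%:R by [].
rewrite (@le_trans _ _ (3 * n.+2%:R))// ?ler_wpM2r//.
by rewrite -natr1 -[n.+1%:R]natr1; lra.
Qed.

Lemma cos1_lt1 : cos 1 < 1 :> R.
Proof.
have pi2 := pi_ge2 R.
by rewrite -[ltRHS]cos0 ltr_cos ?in_itv/= ?lexx ?pi_ge0//; lra.
Qed.

Context (d : measure_display) (T : measurableType d) (P : probability T R).

(** Markov's inequality for [1 - cos (Y / 2^n)]: on the annulus [|Y| / 2^n] lies in [[1, 2]], inside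
    [[0, pi]] where the cosine decreases, so this variable is at least [1 - cos 1]. *)
Lemma prob_annulus_le (Y : {RV P >-> R}) (n : nat) (c : R) :
  (\int[P]_w (cos ((2 ^+ n)^-1 * Y w))%:E = c%:E)%E ->
  (P (Y @^-1` annulus n) <= ((1 - c) / (1 - cos 1))%:E)%E.
Proof.
move=> Ec.
have mE : measurable (Y @^-1` annulus n).
  by apply: measurable_funPTI; exact: measurable_annulus.
have pi2 := pi_ge2 R.
have c1 : 0 < 1 - cos 1 :> R by rewrite subr_gt0 cos1_lt1.
have ic : P.-integrable [set: T] (fun w => (cos ((2 ^+ n)^-1 * Y w))%:E).
  apply: (@bounded_integrable _ _ _ _ _ 1); first exact: measurable_cosY.
  by move=> w; rewrite ler_norml cos_geN1 cos_le1.
have i1 : P.-integrable [set: T] (fun w => 1%:E).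
  by apply: (@bounded_integrable _ _ _ _ (cst 1) 1) => // w; rewrite normr1.
rewrite -(_ : (\int[P]_w (\1_(Y @^-1` annulus n) w)%:E = P (Y @^-1` annulus n))%E); last first.
  by rewrite integral_indic// setIT.
apply: (@le_trans _ _ (\int[P]_w (((1 - cos 1)^-1)%:E * (1%:E - (cos ((2 ^+ n)^-1 * Y w))%:E)))%E).
  apply: ge0_le_integral => //.
  - by apply/measurable_EFinP.
  - apply: measurable_funeM; apply: emeasurable_funB => //.
    exact: (measurable_int P ic).
  - move=> w _; rewrite -EFinB -EFinM lee_fin indicE.
    have [/set_mem /= /andP[h1 h2]|_] := boolP (w \in _); last first.
      by rewrite mulr_ge0// ?invr_ge0 ?(ltW c1)// subr_ge0 cos_le1.
    rewrite mulrC ler_pdivlMr// mul1r lerD2l lerN2 -cos_norm.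
    have p2 : 0 < (2 : R) ^+ n by rewrite exprn_gt0.
    have uE : `|(2 ^+ n)^-1 * Y w| = `|Y w| / 2 ^+ n.
      by rewrite normrM gtr0_norm ?invr_gt0// mulrC.
    have u1 : 1 <= `|(2 ^+ n)^-1 * Y w| by rewrite uE ler_pdivlMr// mul1r.
    have u2 : `|(2 ^+ n)^-1 * Y w| <= 2 by rewrite uE ler_pdivrMr// -exprS ltW.
    move: u1; rewrite le_eqVlt => /predU1P[<-//|u1]; apply: ltW.
    by rewrite ltr_cos ?in_itv/=//; apply/andP; split; lra.
rewrite integralZl//; last exact: integrableB.
rewrite integralB// Ec (_ : (\int[P]_w 1%:E = 1)%E); last first.
  by rewrite integral_cst// mul1e; exact: probability_setT.
rewrite -EFinB -EFinM.
by rewrite mulrC.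
Qed.

(** On the annulus of index [n] the logarithm is [O(n + 1)] and the mass is [O((n + 1) r^n)], so the
    moment is bounded by a convergent series of terms [(n + 1)^2 r^n]. *)
Lemma integrable_log_moment (Y : {RV P >-> R}) (g : R -> R) (phi : nat -> R) (C r : R) :
  is_density P Y g -> 0 < r < 1 -> 0 <= C ->
  (forall n, \int[P]_w (cos ((2 ^+ n)^-1 * Y w))%:E = (phi n)%:E)%E ->
  (forall n, 1 - phi n <= C * n.+1%:R * r ^+ n) ->
  mu.-integrable [set: R] (EFin \o (fun x => g x * ln (1 + x ^+ 2))).
Proof.
move=> [mg [g0 gP]] r01 C0 Ephi phiC.
have [r0 r1] := andP r01.
have ell0 (x : R) : 0 <= ln (1 + x ^+ 2) by rewrite ln_ge0// lerDl sqr_ge0.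
have mell : measurable_fun [set: R] (fun x : R => g x * ln (1 + x ^+ 2)).
  apply: measurable_funM => //; apply: measurableT_comp; first exact: measurable_ln.
  by apply: measurable_funD => //; exact: exprn_measurable.
apply/integrableP; split; first exact/measurable_EFinP.
under eq_integral do rewrite /= ger0_norm ?mulr_ge0//.
pose a n x : \bar R := ((6 * n.+1%:R)%:E * ((g x)%:E * (\1_(annulus n) x)%:E))%E.
have a0 n x : (0 <= a n x)%E by rewrite /a -!EFinM lee_fin !mulr_ge0// indicE.
have ma1 n : measurable_fun [set: R] (fun x : R => (g x)%:E * (\1_(annulus n) x)%:E)%E.
  under eq_fun do rewrite -EFinM; apply/measurable_EFinP; apply: measurable_funM => //.
  exact: measurable_indic (measurable_annulus n).
have ma n : measurable_fun [set: R] (a n) by apply: measurable_funeM; exact: ma1.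
have msum : measurable_fun [set: R] (fun x => \sum_(n <oo) a n x)%E.
  exact: (@ge0_emeasurable_sum _ _ _ setT a xpredT (fun k x _ _ => a0 k x) (fun k _ => ma k)).
(* The annuli cover only [|x| >= 1]; the separate summand [g] handles [|x| < 1], where the logarithm
   is at most [1]. *)
have H x : ((g x * ln (1 + x ^+ 2))%:E <= (g x)%:E + \sum_(n <oo) a n x)%E.
  have s0 : (0 <= \sum_(n <oo) a n x)%E by apply: nneseries_ge0 => n _ _; exact: a0.
  have [x1|x1] := ltP `|x| 1.
    apply: (@le_trans _ _ (g x)%:E); last by rewrite leeDl.
    rewrite lee_fin ler_piMr// (le_trans (ln_leB1 (oneDsqr_gt0 x)))//.
    by rewrite addrC addKr -real_normK ?num_real// exprn_ile1// ltW.
  have [n nx] := dyadic_scale x1.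
  apply: (@le_trans _ _ (a n x)).
    rewrite /a indicE mem_set// mule1 -EFinM lee_fin mulrC ler_wpM2r//.
    exact: ln_annulus.
  apply: (@le_trans _ _ (\sum_(n <oo) a n x)%E); last by rewrite leeDr// lee_fin.
  rewrite (@nneseriesD1 _ _ n)//.
  by rewrite leeDl//; apply: nneseries_ge0 => k _ _; exact: a0.
apply: le_lt_trans.
  apply: (@ge0_le_integral _ _ _ mu _ measurableT _ _ _ _ _ (fun x _ => H x)).
  - by move=> x _; rewrite lee_fin mulr_ge0.
  - exact/measurable_EFinP.
  - apply: emeasurable_funD; first exact/measurable_EFinP.
    exact: msum.
have gE0 (x : R) : [set: R] x -> (0 <= (g x)%:E)%E by rewrite lee_fin.
have mgE : measurable_fun [set: R] (fun x => (g x)%:E) by exact/measurable_EFinP.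
have sE0 (x : R) : [set: R] x -> (0 <= \sum_(n <oo) a n x)%E.
  by move=> _; apply: nneseries_ge0 => n _ _; exact: a0.
rewrite ge0_integralD//.
rewrite integral_nneseries// -gP// preimage_setT probability_setT.
have c1 : 0 < 1 - cos 1 :> R by rewrite subr_gt0 cos1_lt1.
pose K0 := 6 * C / (1 - cos 1).
have K00 : 0 <= K0 by rewrite divr_ge0 ?(ltW c1)// mulr_ge0.
have aI n : (\int[mu]_x a n x <= (K0 * (n.+1%:R ^+ 2 * r ^+ n))%:E)%E.
  have ga0 (x : R) : [set: R] x -> (0 <= (g x)%:E * (\1_(annulus n) x)%:E)%E.
    by move=> _; rewrite -EFinM lee_fin mulr_ge0// indicE.
  rewrite ge0_integralZl_EFin//; last exact: ma1.
  have -> : (\int[mu]_x ((g x)%:E * (\1_(annulus n) x)%:E) = P (Y @^-1` annulus n))%E.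
    rewrite gP; last exact: measurable_annulus.
    rewrite [RHS]integral_mkcond; apply: eq_integral => x _.
    by rewrite patchE indicE; case: ifPn => _; rewrite ?mule1 ?mule0.
  apply: (le_trans (lee_wpmul2l _ (prob_annulus_le (Ephi n)))); first by rewrite lee_fin mulr_ge0.
  rewrite -EFinM lee_fin /K0.
  have -> : 6 * C / (1 - cos 1) * (n.+1%:R ^+ 2 * r ^+ n) =
      6 * n.+1%:R * ((C * n.+1%:R * r ^+ n) / (1 - cos 1)) by ring.
  by rewrite ler_wpM2l ?mulr_ge0// ler_wpM2r ?invr_ge0 ?(ltW c1).
have [K HK] := sqr_geometric_sum_le r01.
apply: (@le_lt_trans _ _ (1 + (K0 * K)%:E)%E); last by rewrite -EFinD ltry.
rewrite leeD2l//; apply: lime_le.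
  by apply: is_cvg_nneseries => n _ _; apply: integral_ge0 => x _; exact: a0.
apply: nearW => N; apply: (@le_trans _ _ (\sum_(0 <= n < N) (K0 * (n.+1%:R ^+ 2 * r ^+ n))%:E)%E).
  by apply: lee_sum => n _; exact: aI.
by rewrite sumEFin lee_fin -mulr_sumr ler_wpM2l.
Qed.

End log_moment.

(** * The stable exponent: decay, behaviour at the origin, scaling *)

Section stable_exponent.
Context {R : realType} (alpha beta sigma mu0 : R).
Hypothesis alpha0 : 0 < alpha.
Hypothesis sigma0 : 0 < sigma.
Local Notation mu := (@lebesgue_measure R).
Local Notation D := (`[0%R, +oo[%classic : set R).
Let s : R := sigma `^ alpha.

Definition stable_rho (t : R) : R := expR (stable_f_re alpha sigma t).
Definition stable_theta (t : R) : R := stable_f_im alpha beta sigma mu0 t.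

Let s0 : 0 < s. Proof. exact: powR_gt0. Qed.

Lemma stable_theta_ge0 (t : R) : 0 <= t -> stable_theta t =
  t * mu0 + s * (t `^ alpha) * beta * stable_Phi alpha t.
Proof.
rewrite /stable_theta /stable_f_im le_eqVlt => /predU1P[<-|t0].
  by rewrite normr0 powR0 ?gt_eqF// !(mulr0, mul0r).
by rewrite gtr0_norm// gtr0_sg// mulr1.
Qed.

Lemma measurable_stable_theta : measurable_fun D stable_theta.
Proof.
apply: (@eq_measurable_fun _ _ _ _ D
  (fun t => t * mu0 + s * (t `^ alpha) * beta * stable_Phi alpha t)).
  by move=> t; rewrite inE/= in_itv/= andbT => t0; rewrite stable_theta_ge0.
apply: measurable_funD; first exact: measurable_funM.
apply: measurable_funM.
  apply: measurable_funM => //; apply: measurable_funM => //.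
  by apply: measurable_funTS; exact: measurable_powR.
rewrite /stable_Phi; case: (alpha == 1) => //.
apply: measurable_funM => //; apply: measurable_funTS.
by apply: measurableT_comp; [exact: measurable_ln|exact: normr_measurable].
Qed.

(** A single term of the exponential series at [s t^alpha] already outgrows any prescribed power of
    [t]. The factor [1 + t] makes one bound serve both [rho] and [t rho]. *)
Lemma stable_rho_le : exists2 K : R, 0 <= K &
  forall t, 0 <= t -> (1 + t) * stable_rho t <= K * (1 + t ^+ 2)^-1.
Proof.
(* [N] makes [alpha N] at least [3], the degree of [(1 + t) (1 + t^2)]. That product is at most [4]
   on [[0, 1]] and at most [4 t^3] beyond, whence the [4] in [K]. *)
pose N := (Num.truncn (3 / alpha)).+1.
have Na : 3 <= alpha * N%:R.
  rewrite mulrC -ler_pdivrMr// ltW// /N.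
  by have /andP[_] := truncn_itv (ltW (divr_gt0 (ltr0n _ 3) alpha0) : 0 <= 3 / alpha).
pose K := 4 * (1 + N`!%:R / s ^+ N).
have q0 : 0 <= N`!%:R / s ^+ N by rewrite divr_ge0// exprn_ge0// ltW.
have K0 : 0 <= K by rewrite mulr_ge0// addr_ge0.
exists K => // t t0.
rewrite ler_pdivlMr ?oneDsqr_gt0// mulrAC.
have rhoE : stable_rho t = (expR (s * t `^ alpha))^-1.
  by rewrite -expRN /stable_rho /stable_f_re mulNr (ger0_norm t0).
have y0 : 0 <= s * t `^ alpha by rewrite mulr_ge0 ?(ltW s0)// powR_ge0.
have [t1|t1] := leP t 1.
  have r1 : stable_rho t <= 1.
    by rewrite rhoE invf_le1 ?expR_gt0// -expR0 ler_expR.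
  have r0 : 0 <= stable_rho t by exact: expR_ge0.
  rewrite (@le_trans _ _ ((1 + t) * (1 + t ^+ 2)))// ?ler_piMr//.
    by rewrite mulr_ge0// addr_ge0// sqr_ge0.
  rewrite /K; nra.
rewrite rhoE ler_pdivrMr ?expR_gt0//.
have hE : (s * t `^ alpha) ^+ N / N`!%:R <= expR (s * t `^ alpha).
  have := @expR_ge1Dxn _ (s * t `^ alpha) (Num.truncn (3 / alpha)) y0.
  by apply: le_trans; rewrite lerDr.
have t3 : t ^+ 3 <= (t `^ alpha) ^+ N.
  rewrite -powR_mulrn ?powR_ge0// -powRrM -powR_mulrn ?(ltW (lt_trans ltr01 t1))//.
  by rewrite ler_powR// ltW.
apply: (@le_trans _ _ (4 * t ^+ 3)); first by nra.
rewrite (@le_trans _ _ (4 * (t `^ alpha) ^+ N))// ?ler_wpM2l//.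
rewrite /K -mulrA ler_wpM2l//.
rewrite (@le_trans _ _ (N`!%:R / s ^+ N * expR (s * t `^ alpha)))//; last first.
  by rewrite ler_wpM2r ?expR_ge0// lerDr.
apply: (@le_trans _ _ (N`!%:R / s ^+ N * ((s * t `^ alpha) ^+ N / N`!%:R))); last first.
  by rewrite ler_wpM2l.
rewrite exprMn le_eqVlt; apply/orP; left; apply/eqP; field.
by rewrite expf_neq0 ?gt_eqF// pnatr_eq0 -lt0n fact_gt0.
Qed.

Lemma measurable_stable_rho : measurable_fun D stable_rho.
Proof.
apply: measurable_funTS; apply: measurableT_comp; first exact: measurable_expR.
change (measurable_fun [set: R] (fun t : R => - s * `|t| `^ alpha)).
apply: measurable_funM => //.
by apply: (measurableT_comp (@measurable_powR R alpha)); exact: normr_measurable.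
Qed.

Lemma integrable_stable_rho : mu.-integrable D (fun t => (stable_rho t)%:E) /\
  mu.-integrable D (fun t => (t * stable_rho t)%:E).
Proof.
have [K K0 HK] := stable_rho_le.
have iw : mu.-integrable D (EFin \o (fun t => K * (1 + t ^+ 2)^-1)).
  apply: Rintegrable_Zl => //.
  by apply: (integrableS _ _ _ (@integrable_oneDsqrV R)).
have r0 t : 0 <= stable_rho t by exact: expR_ge0.
split.
  apply: (Rintegrable_le _ _ _ iw) => //; first exact: measurable_stable_rho.
  move=> t; rewrite /= in_itv/= andbT => t0; rewrite ger0_norm//.
  by apply: le_trans (HK _ t0); rewrite ler_peMl// lerDl.
apply: (Rintegrable_le _ _ _ iw) => //.
  by apply: measurable_funM => //; exact: measurable_stable_rho.
move=> t; rewrite /= in_itv/= andbT => t0; rewrite ger0_norm ?mulr_ge0//.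
by apply: le_trans (HK _ t0); rewrite ler_wpM2r// lerDr.
Qed.

(** The deviation is at most [(1 - rho) + |theta|]. At [t = 2^-n] the drift is of order [2^-n] and
    the stable terms of order [2^(-alpha n)], which the logarithm for [alpha = 1] multiplies by a
    factor linear in [n]. *)
Lemma stable_cf_dyadic : exists C r : R, [/\ 0 < r < 1, 0 <= C &
  forall n, 1 - stable_rho (2 ^+ n)^-1 * cos (stable_theta (2 ^+ n)^-1)
    <= C * n.+1%:R * r ^+ n].
Proof.
pose a : R := 2^-1 `^ alpha.
have a0 : 0 < a by rewrite powR_gt0.
have a1 : a < 1.
  have : (2^-1 : R) `^ alpha < 1 `^ alpha.
    by apply: gt0_ltr_powR; rewrite ?nnegrE// invf_lt1// ltr1n.
  by rewrite powR1.
pose r := Num.max a 2^-1.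
have r01 : 0 < r < 1 by rewrite lt_max a0 gt_max a1 invf_lt1// ltr1n.
have [r0 r1] := andP r01.
have tE n : ((2 : R) ^+ n)^-1 = 2^-1 ^+ n by rewrite exprVn.
have taE n : ((2 : R) ^+ n)^-1 `^ alpha = a ^+ n.
  by rewrite tE -[in LHS]powR_mulrn// -powRrM mulrC powRrM powR_mulrn// powR_ge0.
pose F : R := if alpha == 1 then 2 / pi * ln 2 else `|tan (pi * alpha / 2)|.
have F0 : 0 <= F.
  rewrite /F; case: ifP => // _; rewrite mulr_ge0 ?divr_ge0 ?pi_ge0//.
  by rewrite ln_ge0// ler1n.
have PhiF n : `|stable_Phi alpha (2 ^+ n)^-1| <= F * n.+1%:R.
  rewrite /stable_Phi /F; case: ifP => _; last first.
    by rewrite ler_peMr// ler1n.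
  have p0 : 0 <= 2 / pi :> R by rewrite divr_ge0 ?pi_ge0.
  rewrite normrM normrN (ger0_norm p0) -[leRHS]mulrA ler_wpM2l//.
  have p2 : 0 < ((2 : R) ^+ n)^-1 by rewrite invr_gt0 exprn_gt0.
  rewrite (gtr0_norm p2) lnV ?posrE ?exprn_gt0// normrN lnXn//.
  rewrite ger0_norm ?mulrn_wge0 ?ln_ge0 ?ler1n//.
  by rewrite -[leLHS]mulr_natr ler_wpM2l ?ln_ge0 ?ler1n// ler_nat.
pose C := s + `|mu0| + s * `|beta| * F.
have C0 : 0 <= C by rewrite !addr_ge0// ?mulr_ge0 ?(ltW s0).
exists C, r; split=> // n.
set t := (2 ^+ n)^-1.
have t0 : 0 < t by rewrite invr_gt0 exprn_gt0.
have tr : t <= r ^+ n by rewrite /t tE lerXn2r ?nnegrE ?(ltW r0)// le_max lexx orbT.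
have tar : t `^ alpha <= r ^+ n.
  by rewrite /t taE lerXn2r ?nnegrE ?(ltW r0) ?(ltW a0)// le_max lexx.
have rn0 : 0 <= r ^+ n by rewrite exprn_ge0// ltW.
have n1 : (1 : R) <= n.+1%:R by rewrite ler1n.
have ta0 : 0 <= t `^ alpha by exact: powR_ge0.
have rho0 : 0 <= stable_rho t by exact: expR_ge0.
have rhoE : stable_rho t = expR (- (s * t `^ alpha)).
  by rewrite /stable_rho /stable_f_re mulNr (gtr0_norm t0).
have rho1 : stable_rho t <= 1.
  by rewrite rhoE -expR0 ler_expR oppr_le0 mulr_ge0 ?(ltW s0).
have h1 : 1 - stable_rho t <= s * t `^ alpha.
  by have := expR_ge1Dx (- (s * t `^ alpha)); rewrite -rhoE; lra.
have h2 : 1 - cos (stable_theta t) <= `|stable_theta t|.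
  have := cos_lipschitz 0 (stable_theta t); rewrite cos0 sub0r normrN.
  by apply: le_trans; exact: ler_norm.
have h3 : `|stable_theta t| <= t * `|mu0| + s * t `^ alpha * `|beta| * (F * n.+1%:R).
  rewrite stable_theta_ge0 ?(ltW t0)// (le_trans (ler_normD _ _))//.
  rewrite !normrM (gtr0_norm t0) (gtr0_norm s0) (ger0_norm ta0) lerD2l.
  by rewrite ler_wpM2l ?mulr_ge0 ?(ltW s0)//; exact: PhiF.
have h4 : 1 - stable_rho t * cos (stable_theta t) <= s * t `^ alpha + `|stable_theta t|.
  have : stable_rho t * (1 - cos (stable_theta t)) <= `|stable_theta t|.
    by apply: le_trans h2; rewrite ler_piMl// subr_ge0 cos_le1.
  by lra.
apply: (le_trans h4); rewrite /C.
have k1 : s * t `^ alpha <= s * r ^+ n * n.+1%:R.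
  by rewrite -mulrA ler_wpM2l ?(ltW s0)// (le_trans tar)// ler_peMr.
have k2 : t * `|mu0| <= `|mu0| * r ^+ n * n.+1%:R.
  by rewrite mulrC -mulrA ler_wpM2l// (le_trans tr)// ler_peMr.
have k3 : s * t `^ alpha * `|beta| * (F * n.+1%:R) <=
    s * `|beta| * F * r ^+ n * n.+1%:R.
  rewrite [leLHS](_ : _ = s * `|beta| * F * n.+1%:R * t `^ alpha); last by ring.
  rewrite [leRHS](_ : _ = s * `|beta| * F * n.+1%:R * r ^+ n); last by ring.
  by rewrite ler_wpM2l// !mulr_ge0 ?(ltW s0).
by lra.
Qed.

(* The drift [b] absorbs the failure of strict stability: [(N / n - 1) mu0] in the
   generic case, and the logarithmic correction when [alpha = 1]. *)
Lemma stable_exponent_scaling (n : nat) : (0 < n)%N -> exists b : R,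
  forall t, 0 <= t -> let N := n%:R `^ alpha^-1 in
  expR (n%:R^-1 * stable_f_re alpha sigma (t * N)) = stable_rho t /\
  n%:R^-1 * stable_f_im alpha beta sigma mu0 (t * N) = stable_theta t + t * b.
Proof.
move=> n0; pose N : R := n%:R `^ alpha^-1.
have nR0 : (0 : R) < n%:R by rewrite ltr0n.
have N0 : 0 < N by exact: powR_gt0.
have Na : N `^ alpha = n%:R.
  by rewrite -powRrM mulVf ?gt_eqF// powRr1// ltW.
have tNa t : 0 <= t -> (t * N) `^ alpha = t `^ alpha * n%:R.
  by move=> t0; rewrite powRM ?(ltW N0)// Na.
pose b := if alpha == 1 then s * beta * (- (2 / pi) * ln n%:R) else (N / n%:R - 1) * mu0.
exists b => t t0 /=; rewrite -/N.
have tN0 : 0 <= t * N by rewrite mulr_ge0// ltW.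
split.
  rewrite /stable_rho /stable_f_re (ger0_norm t0) (ger0_norm tN0) tNa//; congr expR.
  by field; rewrite gt_eqF.
rewrite -[stable_f_im _ _ _ _ _]/(stable_theta _) !stable_theta_ge0// tNa//.
rewrite /stable_Phi /b; have [a1|a1] := eqVneq alpha 1; last first.
  by field; rewrite gt_eqF.
have NE : N = n%:R by rewrite /N a1 invr1 powRr1// ltW.
(* The point [t = 0] is separated because splitting [ln (t n)] requires [t > 0]. *)
move: t0; rewrite le_eqVlt => /predU1P[<-|t0].
  by rewrite a1 powRr1// !(mul0r, mulr0, add0r).
rewrite a1 powRr1 ?(ltW t0)// NE normrM (gtr0_norm t0) (gtr0_norm nR0) lnM ?posrE//.
move: (ln n%:R) (ln t) (2 / pi) nR0 => ln lt q.
move: (n%:R : R) => x x0.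
by field; rewrite gt_eqF.
Qed.

End stable_exponent.

(** * The common density of the rescaled increments *)

Section stable_density.
Context {R : realType} (alpha beta sigma mu0 : R).
Hypothesis alpha0 : 0 < alpha.
Hypothesis sigma0 : 0 < sigma.
Local Notation mu := (@lebesgue_measure R).
Local Notation rho := (stable_rho alpha sigma).
Local Notation theta := (stable_theta alpha beta sigma mu0).

Definition stable_density (x : R) : R := pi^-1 * osc_integral theta rho x.

Let mtheta := measurable_stable_theta beta sigma mu0 alpha0.
Let irho := (integrable_stable_rho alpha0 sigma0).1.
Let itrho := (integrable_stable_rho alpha0 sigma0).2.

Lemma stable_density_bounded : exists M, forall x, stable_density x <= M.
Proof.
exists (pi^-1 * (\int[mu]_(t in `[0%R, +oo[) `|rho t|)%R) => x.
rewrite ler_wpM2l ?invr_ge0 ?pi_ge0// (le_trans (ler_norm _))//.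
exact: osc_integral_bounded.
Qed.

Lemma stable_density_lipschitz : exists L, forall x y,
  `|stable_density x - stable_density y| <= L * `|x - y|.
Proof.
exists (pi^-1 * (\int[mu]_(t in `[0%R, +oo[) `|t * rho t|)%R) => x y.
rewrite -mulrBr normrM ger0_norm ?invr_ge0 ?pi_ge0// -mulrA ler_wpM2l ?invr_ge0 ?pi_ge0//.
exact: osc_integral_lipschitz.
Qed.

Context (d : measure_display) (T : measurableType d) (P : probability T R).

Lemma stable_is_density (Y : {RV P >-> R}) :
  (forall t : R, (0 <= t)%R -> \int[P]_w (cos (t * Y w))%:E = (rho t * cos (theta t))%:E)%E ->
  (forall t : R, (0 <= t)%R -> \int[P]_w (sin (t * Y w))%:E = (rho t * sin (theta t))%:E)%E ->
  is_density P Y stable_density.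
Proof. by move=> cY sY; exact: (fourier_inversion cY sY mtheta irho itrho). Qed.

Lemma stable_log_moment (Y : {RV P >-> R}) :
  (forall t : R, (0 <= t)%R -> \int[P]_w (cos (t * Y w))%:E = (rho t * cos (theta t))%:E)%E ->
  is_density P Y stable_density ->
  mu.-integrable [set: R] (EFin \o (fun x => stable_density x * ln (1 + x ^+ 2))).
Proof.
move=> cY dY; have [C [r [r01 C0 HC]]] := stable_cf_dyadic beta mu0 alpha0 sigma0.
apply: (integrable_log_moment dY r01 C0 _ HC) => n.
by apply: cY; rewrite invr_ge0 exprn_ge0.
Qed.

(** The characteristic function of [Z] at [t] is that of [X] at [t n^(1/alpha)] with the phase [t b]
    removed, and the scaling of the exponent makes this [rho e^(i theta)], whatever [n] is. *)
Lemma stable_rescaling (n : nat) (X : {RV P >-> R}) : (0 < n)%N ->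
  has_cf_exp P X n%:R^-1 alpha beta sigma mu0 ->
  exists (b : R) (Z : {RV P >-> R}),
    (forall w, Z w = n%:R `^ alpha^-1 * X w - b) /\ is_density P Z stable_density.
Proof.
move=> n0 cfX; have [b Hb] := stable_exponent_scaling beta sigma mu0 alpha0 n0.
pose N : R := n%:R `^ alpha^-1.
have N0 : 0 < N by rewrite powR_gt0// ltr0n.
pose Zf w := N * X w - b.
have mZ : measurable_fun [set: T] Zf.
  by apply: measurable_funB => //; exact: measurable_funM.
pose Z : {RV P >-> R} := HB.pack_for {mfun T >-> R} Zf (isMeasurableFun.Build _ _ _ _ Zf mZ).
exists b, Z; split=> //.
have ZE t w : t * Z w = (t * N) * (X w - b / N).
  by rewrite /= /Zf; field; rewrite gt_eqF.
have cX t : 0 <= t -> (\int[P]_w (cos (t * X w))%:E =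
    (expR (n%:R^-1 * stable_f_re alpha sigma t) *
     cos (n%:R^-1 * stable_f_im alpha beta sigma mu0 t))%:E)%E.
  by move=> _; exact: (cfX t).1.
have sX t : 0 <= t -> (\int[P]_w (sin (t * X w))%:E =
    (expR (n%:R^-1 * stable_f_re alpha sigma t) *
     sin (n%:R^-1 * stable_f_im alpha beta sigma mu0 t))%:E)%E.
  by move=> _; exact: (cfX t).2.
have tbE t : t * N * (b / N) = t * b by field; rewrite gt_eqF.
apply: stable_is_density => t t0; have tN0 : 0 <= t * N by rewrite mulr_ge0// ltW.
  under eq_integral do rewrite ZE.
  rewrite (integral_cosB cX sX)//; have [-> ->] := Hb t t0.
  by rewrite tbE -cosN; congr (_ * cos _)%:E; ring.
under eq_integral do rewrite ZE.
rewrite (integral_sinB cX sX)//; have [-> ->] := Hb t t0.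
by rewrite tbE; congr (_ * sin _)%:E; ring.
Qed.

(** Rounding [x] to the nearest multiple of [1 / m] is locating [N x - b] among cells of width
    [N / m]. The half in the rounding and the drift [b] go into the offset. *)
Lemma quantize_floor (m : nat) (N b x : R) : (0 < m)%N -> 0 < N ->
  quantize m x = (Num.floor ((N * x - b - (- (N / m%:R) / 2 - b)) / (N / m%:R)))%:~R / m%:R.
Proof.
move=> m0 N0; have mR0 : (0 : R) < m%:R by rewrite ltr0n.
rewrite /quantize; congr ((Num.floor _)%:~R / _).
by field; rewrite !gt_eqF.
Qed.

End stable_density.

(** * Convergence to zero of extended-real suprema *)

Section limit_of_sup.
Context {R : realType}.

Lemma cvg_ereal_sup0 (A : nat -> set \bar R) :
  (forall n x, A n x -> (0 <= x)%E) -> (forall n, A n !=set0) ->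
  (forall eps : R, 0 < eps -> \forall n \near \oo, forall x, A n x -> (x <= eps%:E)%E) ->
  ereal_sup (A n) @[n --> \oo] --> 0%E.
Proof.
move=> A0 An0 H.
have s0 n : (0 <= ereal_sup (A n))%E.
  have [x Ax] := An0 n; exact: le_trans (A0 _ _ Ax) (ereal_sup_ubound Ax).
have sle (eps : R) : 0 < eps -> \forall n \near \oo, (ereal_sup (A n) <= eps%:E)%E.
  move=> /H; apply: filterS => n Hn; exact: ge_ereal_sup.
apply/fine_cvgP; split.
  have := sle 1 ltr01; apply: filterS => n Hn.
  by rewrite ge0_fin_numE// (le_lt_trans Hn)// ltry.
apply/cvgrPdist_le => /= eps eps0; have := sle eps eps0; apply: filterS => n Hn.
have sfin : ereal_sup (A n) \is a fin_num by rewrite ge0_fin_numE// (le_lt_trans Hn)// ltry.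
rewrite sub0r normrN ger0_norm ?fine_ge0//.
by rewrite -lee_fin fineK.
Qed.

End limit_of_sup.

(** * Uniform entropy asymptotics of the quantized increments *)

Unset Implicit Arguments.

Theorem mainTheorem3 (R : realType) (d : measure_display) (T : measurableType d)
  (P : probability T R) (alpha beta sigma mu : R)
  (halpha : 0 < alpha <= 2) (hbeta : -1 <= beta <= 1) (hsigma : 0 < sigma)
  (X1 : nat -> {RV P >-> R}) (X0 : {RV P >-> R})
  (hX1 : forall n : nat, (0 < n)%N ->
          has_cf_exp P (X1 n) (n%:R)^-1 alpha beta sigma mu)
  (hX0 : has_cf_exp P X0 1 alpha beta sigma mu)
  (mf : nat -> nat)
  (hmf : (fun n : nat => (mf n)%:R / (n%:R `^ alpha^-1)) @ \oo --> +oo) :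
  exists g : R -> R,
    is_density P X0 g /\
    lebesgue_measure.-integrable [set: R] (fun x => (g x * ln (g x))%:E) /\
    (fun n : nat =>
       ereal_sup [set `| Hmn P (X1 n) m n * (n%:R^-1)%:E
                         - (ln (m%:R / (n%:R `^ alpha^-1)))%:E
                         - (diff_entropy g)%:E |%E
                 | m in [set m : nat | (mf n <= m)%N]]) @ \oo --> 0%E.

Proof.
have [alpha0 _] := andP halpha.
pose g := stable_density alpha beta sigma mu.
have cX0 t : 0 <= t -> (\int[P]_w (cos (t * X0 w))%:E =
    (stable_rho alpha sigma t * cos (stable_theta alpha beta sigma mu t))%:E)%E.
  by move=> _; have := (hX0 t).1; rewrite !mul1r.
have sX0 t : 0 <= t -> (\int[P]_w (sin (t * X0 w))%:E =
    (stable_rho alpha sigma t * sin (stable_theta alpha beta sigma mu t))%:E)%E.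
  by move=> _; have := (hX0 t).2; rewrite !mul1r.
have dX0 : is_density P X0 g by exact: stable_is_density.
have [mg [g0 gP]] := dX0.
have [M gM] := stable_density_bounded beta mu alpha0 hsigma.
have [L gL] := stable_density_lipschitz beta mu alpha0 hsigma.
have ell : lebesgue_measure.-integrable [set: R] (EFin \o (fun x => g x * ln (1 + x ^+ 2))).
  exact: (stable_log_moment alpha0 hsigma cX0 dX0).
have g1 : (\int[lebesgue_measure]_x (g x)%:E = 1)%E.
  by rewrite -gP// preimage_setT probability_setT.
have ig : lebesgue_measure.-integrable [set: R] (EFin \o g).
  apply/integrableP; split; first exact/measurable_EFinP.
  by under eq_integral do rewrite /= ger0_norm//; rewrite g1 ltry.
have g1R : (\int[lebesgue_measure]_x g x)%R = 1 by rewrite /Rintegral g1.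
exists g; split=> //; split; first exact: (integrable_xlnx g0 ig ell gM).
apply: cvg_ereal_sup0 => [n _ [m _ <-]|n|eps eps0]; first exact: abse_ge0.
  by eexists; exists (mf n) => //=.
have [D0 D00 HD] := quantized_entropy g0 gM gL ig ell g1R P eps0.
have hm : \forall n \near \oo, D0^-1 <= (mf n)%:R / n%:R `^ alpha^-1.
  by move/cvgryPge : hmf; apply.
near=> n => _ [m /= mfm <-].
have n0 : (0 < n)%N by near: n; exact: nbhs_infty_gt.
pose N : R := n%:R `^ alpha^-1.
have N0 : 0 < N by rewrite powR_gt0// ltr0n.
(* Uniformity in [m]: the threshold reached by [mf n] is inherited by every larger [m]. As [D0^-1]
   is positive, this also rules out [m = 0]. *)
have mN : D0^-1 <= m%:R / N.
  apply: (@le_trans _ _ ((mf n)%:R / N)).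
    by rewrite /N; near: n; exact: hm.
  by rewrite ler_wpM2r ?invr_ge0 ?(ltW N0)// ler_nat.
have mR0 : 0 < m%:R :> R.
  have : 0 < m%:R / N by apply: lt_le_trans mN; rewrite invr_gt0.
  by rewrite pmulr_lgt0// invr_gt0.
have m0 : (0 < m)%N by rewrite -(ltr0n R).
have [b [Z [ZE dZ]]] := stable_rescaling alpha0 hsigma n0 (hX1 n n0).
pose D := N / m%:R.
have Dp : 0 < D by rewrite divr_gt0.
have DV : D = (m%:R / N)^-1 by rewrite invf_div.
have DD0 : D <= D0 by rewrite DV -[leRHS]invrK lef_pV2 ?posrE ?invr_gt0 ?divr_gt0.
pose f (k : int) : R := k%:~R / m%:R.
have finj : injective f.
  move=> j k /(mulIf _) h; apply/eqP; rewrite -(eqr_int R); apply/eqP; apply: h.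
  by rewrite invr_neq0// gt_eqF.
have QE w : quantize m (X1 n w) = f (Num.floor ((Z w - (- D / 2 - b)) / D)).
  by rewrite ZE; exact: quantize_floor.
have D01 : 0 < D <= D0 by rewrite Dp.
have /andP[h1 h2] := HD _ Z _ D f dZ finj QE D01.
rewrite /Hmn.
set H := discrete_entropy _ _ in h1 h2 *.
(* The entropy lies between two real bounds, so the remaining computation takes place in [R]. *)
have Hfin : H \is a fin_num.
  by rewrite fin_numE; apply/andP; split; apply/eqP => HE; move: h1 h2; rewrite HE.
move: h1 h2; rewrite -(fineK Hfin) !lee_fin => h1 h2.
have nn : n%:R * fine H * n%:R^-1 = fine H by rewrite mulrAC divff ?mul1r// pnatr_eq0 -lt0n.
(* After this the quantity inside the absolute value is [H - (diff_entropy g - ln D)], which lies in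
   [[0, eps]]. *)
have lnE : ln (m%:R / n%:R `^ alpha^-1) = - ln D by rewrite DV lnV ?opprK// posrE divr_gt0.
by rewrite nn lnE ger0_norm; lra.
Unshelve. all: by end_near. Qed.
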